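(* Let $\mathcal A\subset\mathcal G$ be connected matrix Lie groups with Lie algebras $\mathfrak a\subset\mathfrak g$, let $\langle,\rangle$ be a nondegenerate bi-invariant symmetric bilinear form on $\mathfrak g$ whose restriction to $\mathfrak a$ is nondegenerate, let $\mathcal B$ be an invertible intertwining operator on $\mathfrak a$ and $\beta_0\neq0$ real, $\vec\beta=(\beta_0,\mathcal B)$. Equip $\mathcal G$ with the left-invariant metric induced by $$\langle\mathtt X_1,\mathtt X_2\rangle_{\vec\beta}:=\beta_0\langle\mathtt X_1,\mathtt X_2\rangle-\langle(\mathcal B+\beta_0I_{\mathfrak a})\mathcal P_{\mathfrak a}\mathtt X_1,\mathcal P_{\mathfrak a}\mathtt X_2\rangle .$$ Let $\mathcal K\subset\mathcal G$ be a closed Lie subgroup commuting with $\mathcal A$, whose Lie algebra $\mathfrak k$ is nondegenerate and satisfies $[\mathfrak k,\mathfrak a]=\{0\}$ and $\langle\mathfrak k,\mathfrak a\rangle=\{0\}$; let $\mathfrak m$ be the $\langle,\rangle$-orthogonal complement of $\mathfrak k$ in $\mathfrak g$, and equip $\mathcal G/\mathcal K$ with the quotient metric, so that the horizontal space at $X\in\mathcal G$ is $\mathcal H_X=X\mathfrak m$. Expressing the horizontal connection for two horizontal vector fields $\mathtt Y,\mathtt Z$ as $\nabla^{\mathcal H}_{\mathtt Y}\mathtt Z=\mathrm D_{\mathtt Y}\mathtt Z+\Gamma^{\mathcal H}(\mathtt Y,\mathtt Z)$, the horizontal Christoffel function for two horizontal vectors $\xi,\eta$ at $X\in\mathcal G$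 is $$\Gamma^{\mathcal H}(\xi,\eta)=-\tfrac12\big(\xi X^{-1}\eta+\eta X^{-1}\xi+X\,\mathcal P_{\mathfrak k}[X^{-1}\xi,X^{-1}\eta]\big)$$ $$+\tfrac12X\Big([(I_{\mathfrak a}+\beta_0^{-1}\mathcal B)\mathcal P_{\mathfrak a}(X^{-1}\xi),X^{-1}\eta]+[(I_{\mathfrak a}+\beta_0^{-1}\mathcal B)\mathcal P_{\mathfrak a}(X^{-1}\eta),X^{-1}\xi]\Big).$$ The horizontal geodesic $\gamma$ with $\gamma(0)=X$, $\dot\gamma(0)=\xi$, where $\xi$ is horizontal, is $$\gamma(t)=X\operatorname{expm}\!\Big(t\big(-(I_{\mathfrak a}+\beta_0^{-1}\mathcal B)\mathcal P_{\mathfrak a}(X^{-1}\xi)+X^{-1}\xi\big)\Big)\operatorname{expm}\!\Big(t(I_{\mathfrak a}+\beta_0^{-1}\mathcal B)\mathcal P_{\mathfrak a}(X^{-1}\xi)\Big).$$ Let $\mathtt V=X^{-1}\xi\in\mathfrak m$. The parallel transport of $\eta\in\mathcal H_X$ along $\gamma$ from $0$ to $t$ is $$\mathtt T(\gamma)_0^t\eta=X\operatorname{expm}\!\Big(t\big(\mathtt V-(I_{\mathfrak a}+\beta_0^{-1}\mathcal B)\mathcal P_{\mathfrak a}\mathtt V\big)\Big)\operatorname{expv}(t\mathrm P_{\mathtt V},X^{-1}\eta)\operatorname{expm}\!\Big(t(I_{\mathfrak a}+\beta_0^{-1}\mathcal B)\mathcal P_{\mathfrak a}\mathtt V\Big),$$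 where $$\mathrm P_{\mathtt V}:\mathtt B\mapsto\tfrac12\Big(\mathcal P_{\mathfrak m}[\mathtt B,\mathtt V]+[(I_{\mathfrak a}+\beta_0^{-1}\mathcal B)\mathcal P_{\mathfrak a}\mathtt V,\mathtt B]-[(I_{\mathfrak a}+\beta_0^{-1}\mathcal B)\mathcal P_{\mathfrak a}\mathtt B,\mathtt V]\Big).$$ The operator $\mathrm P_{\mathtt V}$ maps $\mathfrak m$ to itself and is antisymmetric in the pairing $\langle,\rangle_{\vec\beta}$ on $\mathfrak m$.
   Context: A matrix Lie group is a Lie subgroup of some $\mathrm{GL}(N)$, with $T_X\mathcal G=X\mathfrak g$. The form $\langle,\rangle$ is bi-invariant if $\operatorname{Ad}$-invariant, equivalently (connected group) $\langle\mathtt A,[\mathtt B,\mathtt C]\rangle=\langle\mathtt B,[\mathtt C,\mathtt A]\rangle=\langle\mathtt C,[\mathtt A,\mathtt B]\rangle$. A subspace is nondegenerate if $\langle,\rangle$ restricts to a nondegenerate form on it. An intertwining operator on $\mathfrak a$ is a linear operator $\mathcal B:\mathfrak a\to\mathfrak a$, symmetric with respect to $\langle,\rangle$, such that $(\mathtt A_1,\mathtt A_2)\mapsto\langle\mathtt A_1,\mathcal B\mathtt A_2\rangle$ is bi-invariant on $\mathfrak a$. $I_{\mathfrak a}$ is the identity on $\mathfrak a$; $\mathcal P_{\mathfrak a},\mathcal P_{\mathfrak k},\mathcal P_{\mathfrak m}$ are the $\langle,\rangle$-orthogonal projections of $\mathfrak g$ onto $\mathfrak a,\mathfrak k,\mathfrak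 m$. The left-invariant (pseudo-Riemannian) metric is $\langle\xi,\eta\rangle_X=\langle X^{-1}\xi,X^{-1}\eta\rangle_{\vec\beta}$; $\mathcal K$ acts on $\mathcal G$ by right multiplication by isometries, and the projection $\mathcal G\to\mathcal G/\mathcal K$ is a pseudo-Riemannian submersion. The horizontal connection $\nabla^{\mathcal H}_{\mathtt Y}\mathtt Z$ is the horizontal projection of the Levi-Civita derivative $\nabla_{\mathtt Y}\mathtt Z$ on $\mathcal G$; for horizontal lifts of vector fields on $\mathcal G/\mathcal K$ it is the horizontal lift of the Levi-Civita derivative of $\mathcal G/\mathcal K$. Vector fields are regarded as matrix-valued functions and $\mathrm D$ is the directional derivative. Horizontal geodesics and parallel transport of horizontal vectors are the horizontal lifts of geodesics and parallel transport of $\mathcal G/\mathcal K$; i.e. $\mathtt T(\gamma)_0^t\eta$ is the horizontal lift at $\gamma(t)$ of the parallel transport, along the projected geodesic, of the projection of $\eta$. $\operatorname{expm}$ is the matrix exponential and $\operatorname{expv}(t\mathrm P,v)=e^{t\mathrm P}v$ for a linear operator $\mathrm P$ on a matrix space. *)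

(* Defs.v *)
From HB Require Import structures.
From mathcomp Require Import all_boot all_order all_algebra.
From mathcomp Require Import all_classical all_reals all_analysis.
Set Implicit Arguments.
Unset Strict Implicit.
Unset Printing Implicit Defensive.
Import Order.TTheory GRing.Theory Num.Theory.
Import numFieldNormedType.Exports.
Local Open Scope classical_set_scope.
Local Open Scope ring_scope.

(* Real square matrices of size N = n.+1 >= 1, so that ring notations apply:
   X * Y is the matrix product and X^-1 the matrix inverse. *)

Definition expm (R : realType) (n : nat) (A : 'M[R]_n.+1) : 'M[R]_n.+1 :=
  lim (series (fun k => k`!%:R^-1 *: A ^+ k) @ \oo).

Definition expv (R : realType) (n : nat) (P : 'M[R]_n.+1 -> 'M[R]_n.+1)
    (v : 'M[R]_n.+1) : 'M[R]_n.+1 :=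
  lim (series (fun k => k`!%:R^-1 *: iter k P v) @ \oo).

Definition lie_bracket (R : realType) (n : nat) (A B : 'M[R]_n.+1) :
    'M[R]_n.+1 :=
  A * B - B * A.

Fixpoint Ck (R : realType) (V W : normedModType R) (k : nat) (U : set V)
    (f : V -> W) : Prop :=
  match k with
  | 0%N => forall x, U x -> {for x, continuous f}
  | k'.+1 => (forall x, U x -> differentiable f x) /\
             (forall v : V, Ck k' U ('D_v f))
  end.

(* Meant for open U. *)
Definition Cinf (R : realType) (V W : normedModType R) (U : set V)
    (f : V -> W) : Prop :=
  forall k, Ck k U f.

Section LieSubgroups.
Context (R : realType) (n : nat).
Local Notation M := 'M[R]_n.+1.

Definition is_subgroup_GL (G : set M) : Prop :=
  [/\ G 1,
      (forall X Y, G X -> G Y -> G (X * Y)) &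
      (forall X, G X -> X \is a GRing.unit /\ G X^-1)].

Definition is_lie_algebra_of (G : set M) (g : {vspace M}) : Prop :=
  forall A, A \in g <-> (forall t : R, G (expm (t *: A))).

(* Connected Lie subgroup of GL(N), not necessarily closed: its Lie algebra is
   {A | exp(tA) \in G for all t}, and connectedness is the condition that G is
   generated by the exponentials of its Lie algebra (Hall, Lie Groups, Lie
   Algebras, and Representations, 2nd ed., Definition 5.19). *)
Definition connected_lie_subgroup (G : set M) (g : {vspace M}) : Prop :=
  [/\ is_subgroup_GL G,
      is_lie_algebra_of G g,
      {in g &, forall A B, lie_bracket A B \in g} &
      forall X, G X ->
        exists2 s : seq M, {subset s <= g} & X = \prod_(A <- s) expm A].

(* A smooth curve in the (immersed) manifold G: smooth as a matrix-valued
   function, with values in G and velocity in T_{c t} G = (c t) g. *)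
Definition smooth_curve (G : set M) (g : {vspace M}) (c : R -> M) : Prop :=
  Cinf setT c /\ forall t, G (c t) /\ (c t)^-1 * derive1 c t \in g.

(* Open balls of the left-invariant distance of G. They are a base of the
   manifold topology of G, which is finer than the topology induced by M when
   G is not closed in GL(N). *)
Definition lie_ball (G : set M) (g : {vspace M}) (X : M) (e : R) : set M :=
  [set Y | exists c : R -> M,
    [/\ smooth_curve G g c, c 0 = X, c 1 = Y &
        forall t, 0 <= t <= 1 -> `|(c t)^-1 * derive1 c t| < e]].

(* By Cartan's theorem a subgroup closed in G is a Lie subgroup, with Lie
   algebra the subspace {A | exp(tA) \in K for all t}. K need not be
   connected. *)
Definition closed_lie_subgroup (G : set M) (g : {vspace M})
    (K : set M) (k : {vspace M}) : Prop :=
  [/\ is_subgroup_GL K, K `<=` G, is_lie_algebra_of K k &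
      forall X, G X ->
        (forall e, 0 < e -> exists2 Y, lie_ball G g X e Y & K Y) -> K X].

(* f is smooth on the manifold G: locally, for the manifold topology of G, it
   is the restriction of a smooth function on an open set of matrices. Only
   the values of f on G matter. *)
Definition smooth_on (W : normedModType R) (G : set M) (g : {vspace M})
    (f : M -> W) : Prop :=
  forall X, G X -> exists (U : set M) (F : M -> W) (e : R),
    [/\ open U, U X, Cinf U F, 0 < e &
        forall Y, lie_ball G g X e Y -> U Y -> f Y = F Y].

(* Directional derivative of f at X \in G along xi \in T_X G, computed on the
   curve t |-> X exp(t X^-1 xi) in G since f is only significant on G. *)
Definition dirD (W : normedModType R) (f : M -> W) (X xi : M) : W :=
  derive1 (fun t : R => f (X * expm (t *: (X^-1 * xi)))) 0.

Definition vector_field (G : set M) (g : {vspace M}) (Z : M -> M) : Prop :=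
  smooth_on G g Z /\ forall X, G X -> X^-1 * Z X \in g.

Definition field_bracket (Y Z : M -> M) (X : M) : M :=
  dirD Z X (Y X) - dirD Y X (Z X).

End LieSubgroups.

Section Forms.
Context (R : realType) (n : nat).
Local Notation M := 'M[R]_n.+1.

Definition sym_bilinear_on (U : {vspace M}) (b : M -> M -> R) : Prop :=
  {in U &, forall x y, b x y = b y x} /\
  (forall (c : R) x y z, x \in U -> y \in U -> z \in U ->
     b (c *: x + y) z = c * b x z + b y z).

Definition nondegenerate_on (U : {vspace M}) (b : M -> M -> R) : Prop :=
  forall x, x \in U -> {in U, forall y, b x y = 0} -> x = 0.

Definition bi_invariant (G : set M) (g : {vspace M}) (b : M -> M -> R) : Prop :=
  sym_bilinear_on g b /\
  forall X, G X ->
    {in g &, forall A B, b (X * A * X^-1) (X * B * X^-1) = b A B}.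

Definition linear_on (U : {vspace M}) (f : M -> M) : Prop :=
  [/\ {in U, forall x, f x \in U} &
      forall c : R, {in U &, forall x y, f (c *: x + y) = c *: f x + f y}].

Definition intertwining (H : set M) (a : {vspace M}) (b : M -> M -> R)
    (B : M -> M) : Prop :=
  [/\ linear_on a B,
      {in a &, forall x y, b (B x) y = b x (B y)} &
      bi_invariant H a (fun x y => b x (B y))].

(* The b-orthogonal projection of x on U; well defined when b is nondegenerate
   on U. *)
Definition orthproj (b : M -> M -> R) (U : set M) (x : M) : M :=
  xget 0 [set y | U y /\ forall z, U z -> b (x - y) z = 0].

Definition orthocomp (b : M -> M -> R) (g k : {vspace M}) : set M :=
  [set x | x \in g /\ {in k, forall z, b x z = 0}].

Definition form_beta (b : M -> M -> R) (a : {vspace M}) (beta0 : R)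
    (B : M -> M) (x y : M) : R :=
  let Pa := orthproj b [set` a] in
  beta0 * b x y - b (B (Pa x) + beta0 *: Pa x) (Pa y).

(* The left-invariant metric on G induced by the form q on its Lie algebra. *)
Definition left_metric (q : M -> M -> R) (X xi eta : M) : R :=
  q (X^-1 * xi) (X^-1 * eta).

End Forms.

Section Connections.
Context (R : realType) (n : nat).
Local Notation M := 'M[R]_n.+1.

(* nab is the Levi-Civita connection, for the metric induced by q, on the
   space of vector fields F, with ring of functions C and Lie bracket br. It is
   used both for G and, through horizontal lifts, for G/K. *)
Definition levi_civita (G : set M) (q : M -> M -> R)
    (C : set (M -> R)) (F : set (M -> M))
    (br : (M -> M) -> (M -> M) -> M -> M)
    (nab : (M -> M) -> (M -> M) -> M -> M) : Prop :=
  [/\ forall Y Z, F Y -> F Z -> F (nab Y Z),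
      forall f Y Y' Z, C f -> F Y -> F Y' -> F Z -> forall X, G X ->
        nab (fun X => f X *: Y X + Y' X) Z X = f X *: nab Y Z X + nab Y' Z X,
      forall f Y Z Z', C f -> F Y -> F Z -> F Z' -> forall X, G X ->
        nab Y (fun X => f X *: Z X + Z' X) X =
        dirD f X (Y X) *: Z X + f X *: nab Y Z X + nab Y Z' X,
      forall Y Z, F Y -> F Z -> forall X, G X ->
        nab Y Z X - nab Z Y X = br Y Z X &
      forall Y Z W, F Y -> F Z -> F W -> forall X, G X ->
        dirD (fun X => left_metric q X (Z X) (W X)) X (Y X) =
        left_metric q X (nab Y Z X) (W X) + left_metric q X (Z X) (nab Y W X)].

Definition levi_civita_G (G : set M) (g : {vspace M}) (q : M -> M -> R)
    (nab : (M -> M) -> (M -> M) -> M -> M) : Prop :=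
  levi_civita G q (smooth_on G g (W := R)) (vector_field G g)
    (@field_bracket R n) nab.

(* The horizontal space at X: the metric-orthogonal complement, in
   T_X G = X g, of the tangent space X k of the fibre X K of G -> G/K. *)
Definition Hor (g k : {vspace M}) (q : M -> M -> R) (X : M) : set M :=
  [set xi | X^-1 * xi \in g /\
            {in k, forall z, left_metric q X xi (X * z) = 0}].

Definition hproj (g k : {vspace M}) (q : M -> M -> R) (X xi : M) : M :=
  orthproj (left_metric q X) (Hor g k q X) xi.

Definition horizontal_field (G : set M) (g k : {vspace M}) (q : M -> M -> R)
    (Z : M -> M) : Prop :=
  vector_field G g Z /\ forall X, G X -> Hor g k q X (Z X).

Definition horizontal_connection (g k : {vspace M}) (q : M -> M -> R)
    (nab : (M -> M) -> (M -> M) -> M -> M) (Y Z : M -> M) (X : M) : M :=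
  hproj g k q X (nab Y Z X).

(* The manifold G/K is described on G. Its smooth functions, composed with the
   projection pi : G -> G/K, are the smooth functions on G that are constant on
   the cosets X K. Its vector fields are represented by their horizontal lifts,
   which are the smooth horizontal fields Z with d pi (Z X) constant on cosets,
   that is, with Z (X k) = Z X k. The quotient metric of two fields is the
   metric of their lifts, and their Lie bracket lifts to the horizontal part of
   the bracket of the lifts. *)
Definition quotient_function (G : set M) (g : {vspace M}) (K : set M)
    (f : M -> R) : Prop :=
  smooth_on G g f /\ forall X k, G X -> K k -> f (X * k) = f X.

Definition quotient_field (G : set M) (g : {vspace M}) (K : set M)
    (k : {vspace M}) (q : M -> M -> R) (Z : M -> M) : Prop :=
  horizontal_field G g k q Z /\
  forall X h, G X -> K h -> Z (X * h) = Z X * h.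

Definition levi_civita_quotient (G : set M) (g : {vspace M}) (K : set M)
    (k : {vspace M}) (q : M -> M -> R)
    (nab : (M -> M) -> (M -> M) -> M -> M) : Prop :=
  levi_civita G q (quotient_function G g K) (quotient_field G g K k q)
    (fun Y Z X => hproj g k q X (field_bracket Y Z X)) nab.

Definition horizontal_curve (G : set M) (g k : {vspace M}) (q : M -> M -> R)
    (gamma : R -> M) : Prop :=
  smooth_curve G g gamma /\ forall t, Hor g k q (gamma t) (derive1 gamma t).

(* Horizontal lifts along gamma of the vector fields along pi \o gamma. *)
Definition horizontal_along (g k : {vspace M}) (q : M -> M -> R)
    (gamma zeta : R -> M) : Prop :=
  Cinf setT zeta /\ forall t, Hor g k q (gamma t) (zeta t).

(* Dt is (the horizontal lift of) the covariant derivative of vector fields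
   along the curve pi \o gamma of G/K, gamma being a horizontal curve and nab
   the Levi-Civita connection of G/K. *)
Definition covariant_along (G : set M) (g : {vspace M}) (K : set M)
    (k : {vspace M}) (q : M -> M -> R)
    (nab : (M -> M) -> (M -> M) -> M -> M) (gamma : R -> M)
    (Dt : (R -> M) -> R -> M) : Prop :=
  let F := horizontal_along g k q gamma in
  [/\ forall zeta, F zeta -> F (Dt zeta),
      forall zeta zeta', F zeta -> F zeta' -> forall t,
        Dt (fun s => zeta s + zeta' s) t = Dt zeta t + Dt zeta' t,
      forall (f : R -> R) zeta, Cinf setT f -> F zeta -> forall t,
        Dt (fun s => f s *: zeta s) t = derive1 f t *: zeta t + f t *: Dt zeta t &
      forall Y Z t, quotient_field G g K k q Y -> quotient_field G g K k q Z ->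
        Y (gamma t) = derive1 gamma t ->
        Dt (Z \o gamma) t = nab Y Z (gamma t)].

Definition parallel_along (G : set M) (g : {vspace M}) (K : set M)
    (k : {vspace M}) (q : M -> M -> R)
    (nab : (M -> M) -> (M -> M) -> M -> M) (gamma zeta : R -> M) : Prop :=
  horizontal_along g k q gamma zeta /\
  exists2 Dt, covariant_along G g K k q nab gamma Dt &
              forall t, Dt zeta t = 0.

(* gamma is the horizontal lift of a geodesic of G/K. *)
Definition horizontal_geodesic (G : set M) (g : {vspace M}) (K : set M)
    (k : {vspace M}) (q : M -> M -> R)
    (nab : (M -> M) -> (M -> M) -> M -> M) (gamma : R -> M) : Prop :=
  horizontal_curve G g k q gamma /\
  parallel_along G g K k q nab gamma (derive1 gamma).

(* eta' is the horizontal lift at gamma t of the parallel transport, along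
   pi \o gamma from 0 to t, of the projection of eta. *)
Definition parallel_transport (G : set M) (g : {vspace M}) (K : set M)
    (k : {vspace M}) (q : M -> M -> R)
    (nab : (M -> M) -> (M -> M) -> M -> M) (gamma : R -> M) (t : R)
    (eta eta' : M) : Prop :=
  exists zeta : R -> M,
    [/\ parallel_along G g K k q nab gamma zeta, zeta 0 = eta & zeta t = eta'].

End Connections.

(* Main.v *)
Require Import Defs.
From HB Require Import structures.
From mathcomp Require Import all_boot all_order all_algebra.
From mathcomp Require Import perm.
From mathcomp Require Import all_classical all_reals all_analysis.
From mathcomp Require Import ring lra.
Set Implicit Arguments.
Unset Strict Implicit.
Unset Printing Implicit Defensive.
Import Order.TTheory GRing.Theory Num.Theory.
Import numFieldNormedType.Exports.
Local Open Scope classical_set_scope.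
Local Open Scope ring_scope.

(** The proof reads everything in the left trivialisation, where a vector xi at X
becomes X^-1 xi in the Lie algebra g, and compares the deformed metric q with
the bi-invariant form b.

Write T = (I + B / beta0) P_a.  Then q x y = beta0 b (x - T x) y on g
([qE]), and T is b-symmetric, takes its values in a, and commutes with ad s for
s in a ([T_adj], [T_ad]): for P_a because ad s preserves a and is
b-antisymmetric, and for B because both b and (x, y) |-> b x (B y) are
ad-invariant on a and b is nondegenerate there.  All the algebra is an
abstract computation with these three properties (section MetricLieAlgebra).
The point is that T ([T y, z] + [T z, y]) = [T y, T z] + [T z, T y] = 0, so
that the three terms of the Koszul formula for q combine into the q-pairing
with ([y, z] + [T y, z] + [T z, y]) / 2 ([koszul_solve]).  The antisymmetry of
the transport operator P_V is another computation of the same kind.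

The Koszul formula needs only the metric and torsion axioms at one point, with
a third field W of prescribed value.  On G, W is left-invariant
([connectionG]).  On G/K it must commute with K on the right: the horizontal
part of a right-invariant field does, and such fields take every horizontal
value at every point ([lifted_killing], [connectionQ]).

The same fields determine the covariant derivative along a horizontal curve
gamma without any partition of unity: if c_i are the coordinates of
zeta gamma^-1 in a basis e_i of g, a horizontal zeta along gamma is the sum of
c_i Z_i(gamma), where Z_i is the field attached to e_i ([covariant_unique]).
So zeta = gamma v is parallel exactly when v' = - Gamma (u, v), where
u = gamma^-1 gamma' and Gamma is the Christoffel term [h_christoffel]
([parallelP]).

For a geodesic u' = - [T u, u].  Applying P_a gives (P_a u)' = 0, because B
commutes with ad w for w in a and [B w, w] = - B [w, w] = 0; this makes the
quadratic equation linear, T u being a constant S = T V.  Hence u = Ad (exp (- t S)) V,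
and gamma exp (- t S) solves Y' = Y (V - S) ([geodesic_unique]).  For parallel
transport, conjugating v by exp (t S) turns the equation into w' = P_V w, since
Ad (exp (t S)) commutes with the brackets, with T and with P_m
([parallel_Ad]).  Every differential equation involved is thus linear with
constant coefficients, and is solved by the exponential series
([expv_unique]). *)

(** * Differential calculus of matrix-valued functions *)

Lemma cvg_sum_fin (R : numFieldType) (V : normedModType R) (T : Type)
    (F : set_system T) (FF : Filter F) (I : Type) (r : seq I)
    (f : I -> T -> V) (l : I -> V) :
  (forall i, f i @ F --> l i) ->
  (fun x => \sum_(i <- r) f i x) @ F --> \sum_(i <- r) l i.
Proof.
move=> fl; elim: r => [|i r IH].
  rewrite big_nil (_ : (fun _ => _) = cst 0); first exact: cvg_cst.
  by apply/funext => x; rewrite big_nil.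
rewrite big_cons (_ : (fun _ => _) = f i + (fun y => \sum_(i <- r) f i y)).
  exact: cvgD.
by apply/funext => y; rewrite big_cons.
Qed.

(** Fréchet differentiability is a local property. *)
Lemma near_is_diff (R : realFieldType) (V W : normedModType R) (f g df : V -> W)
    (x : V) :
  {near x, f =1 g} -> is_diff x f df -> is_diff x g df.
Proof.
move=> fg [fd <-].
have eg : g \o shift x = cst (g x) + 'd f x +o_ 0 id.
  apply/eqaddoP => _/posnumP[e].
  have /eqaddoP/(_ e%:num (gt0 e)) := diff_locally fd.
  rewrite -(nbhs_singleton fg).
  have : \forall h \near 0, f (h + x) = g (h + x).
    by have := fg; rewrite (near_shift 0 x); apply: filterS => h; rewrite /= subr0.
  by apply: filterS2 => h fgh; rewrite !fctE /= fgh.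
have dE : 'd g x = 'd f x :> (V -> W) by apply: diff_unique eg; exact: diff_continuous.
by apply: DiffDef => //; apply/diff_locallyP; rewrite dE; split => //;
  exact: (diff_continuous fd).
Qed.

Section MatrixCalculus.
Context (R : realType) (m n : nat).
Local Notation Mx := 'M[R]_(m, n).

(** Linear maps on matrices are handled through the predicate [linear]
and this expansion: continuity and differentiability of linear and bilinear
maps reduce to those of the coordinates. *)
Lemma linear_mxE (W : lmodType R) (f : Mx -> W) : linear f ->
  forall x, f x = \sum_i \sum_j x i j *: f (delta_mx i j).
Proof.
move=> lf x; pose fL : {linear Mx -> W} := HB.pack f (GRing.isLinear.Build _ _ _ _ f lf).
rewrite -[f]/(fL : _ -> _) {1}(matrix_sum_delta x) linear_sum; apply: eq_bigr => i _.
by rewrite linear_sum; apply: eq_bigr => j _; rewrite linearZ.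
Qed.

Lemma differentiable_sum_fin (V W : normedModType R) (I : Type) (r : seq I)
    (f : I -> V -> W) (x : V) :
  (forall i, differentiable (f i) x) ->
  differentiable (fun y => \sum_(i <- r) f i y) x.
Proof.
move=> df; elim: r => [|i r IH].
  rewrite (_ : (fun _ => _) = cst 0); first exact: differentiable_cst.
  by apply/funext => y; rewrite big_nil.
rewrite (_ : (fun _ => _) = f i + (fun y => \sum_(i <- r) f i y)).
  exact: differentiableD.
by apply/funext => y; rewrite big_cons.
Qed.

Lemma differentiable_mx (V : normedModType R) (f : V -> Mx) (x : V) :
  (forall i j, differentiable (fun y => f y i j) x) -> differentiable f x.
Proof.
move=> df; rewrite (_ : f = fun y => \sum_i \sum_j f y i j *: delta_mx i j).
  do 2 apply: differentiable_sum_fin => ?.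
  exact: differentiableZl.
by apply/funext => y; rewrite -matrix_sum_delta.
Qed.

Lemma linear_mx_differentiable (W : normedModType R) (f : Mx -> W) x :
  linear f -> differentiable f x.
Proof.
move=> lf; rewrite (_ : f = fun y => \sum_i \sum_j y i j *: f (delta_mx i j)).
  do 2 apply: differentiable_sum_fin => ?.
  exact/differentiableZl/differentiable_coord.
by apply/funext => y; rewrite -linear_mxE.
Qed.

Lemma linear_mx_continuous (W : normedModType R) (f : Mx -> W) :
  linear f -> continuous f.
Proof. by move=> lf x; apply/differentiable_continuous/linear_mx_differentiable. Qed.

Lemma is_diff_linear_mx (V W : normedModType R) (f : Mx -> W) (g dg : V -> Mx) x :
  linear f -> is_diff x g dg -> is_diff x (fun y => f (g y)) (fun v => f (dg v)).
Proof.
move=> lf gx.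
pose fL : {linear Mx -> W} := HB.pack f (GRing.isLinear.Build _ _ _ _ f lf).
have ff : is_diff (g x) f f.
  apply: DiffDef; first exact: linear_mx_differentiable.
  rewrite -[f]/(fL : _ -> _) diff_lin //; exact: linear_mx_continuous.
exact: (is_diff_comp gx ff).
Qed.

End MatrixCalculus.

Section Bilinear.
Context (R : realType) (m n p r : nat).

Lemma is_diff_bilinear_mx (V W : normedModType R)
    (f : 'M[R]_(m, n) -> 'M[R]_(p, r) -> W)
    (g dg : V -> 'M[R]_(m, n)) (h dh : V -> 'M[R]_(p, r)) x :
  (forall y, linear (f^~ y)) -> (forall y, linear (f y)) ->
  is_diff x g dg -> is_diff x h dh ->
  is_diff x (fun y => f (g y) (h y)) (fun v => f (dg v) (h x) + f (g x) (dh v)).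
Proof.
move=> l1 l2 gx hx.
have bil : bilinear_for (GRing.Scale.Law.clone _ _ *:%R _)
  (GRing.Scale.Law.clone _ _ *:%R _) f.
  by split => u a v w /=; [apply: l1|apply: l2].
pose fB : {bilinear 'M[R]_(m, n) -> 'M[R]_(p, r) -> W} :=
  HB.pack f (bilinear_isBilinear.Build R _ _ W _ _ f bil).
have fc : continuous (fun q : 'M[R]_(m, n) * 'M[R]_(p, r) => fB q.1 q.2).
  rewrite (_ : (fun _ => _) = fun q : 'M[R]_(m, n) * 'M[R]_(p, r) =>
      \sum_i \sum_j (q.1 i j) *: f (delta_mx i j) q.2); last first.
    by apply/funext => q /=; apply: (linear_mxE (l1 _)).
  move=> q; apply: cvg_sum_fin => i; apply: cvg_sum_fin => j.
  apply: cvgZ.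
    apply: (@cvg_comp _ _ _ fst (fun N : 'M[R]_(m, n) => N i j) _ (nbhs q.1)).
      exact: cvg_fst.
    exact: coord_continuous.
  apply: (@cvg_comp _ _ _ snd (f (delta_mx i j)) _ (nbhs q.2)).
    exact: cvg_snd.
  exact: (linear_mx_continuous (l2 _)).
have fd : is_diff (g x, h x) (fun q : 'M[R]_(m, n) * 'M[R]_(p, r) => fB q.1 q.2)
    (fun q => f (g x) q.2 + f q.1 (h x)).
  by apply: DiffDef; [exact: differentiable_bilin|rewrite diff_bilin].
have [dc ec] := is_diff_comp (is_diff_pair gx hx) fd.
apply: DiffDef; first exact: dc.
by rewrite ec; apply/funext => v /=; rewrite addrC.
Qed.
End Bilinear.

Section Square.
Context (R : realType) (n : nat).
Local Notation M := 'M[R]_n.+1.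

Lemma is_diff_mulmx (V : normedModType R) (f df g dg : V -> M) x :
  is_diff x f df -> is_diff x g dg ->
  is_diff x (fun y => f y * g y) (fun v => df v * g x + f x * dg v).
Proof.
move=> fx gx; apply: (is_diff_bilinear_mx (f := fun a b : M => a * b)) => // y c u v.
  by rewrite mulrDl scalerAl.
by rewrite mulrDr scalerAr.
Qed.

Lemma differentiable_prod_fin (V : normedModType R) (I : Type) (r : seq I)
    (f : I -> V -> R) (x : V) :
  (forall i, differentiable (f i) x) ->
  differentiable (fun y => \prod_(i <- r) f i y) x.
Proof.
move=> df; elim: r => [|i r IH].
  rewrite (_ : (fun _ => _) = cst 1); first exact: differentiable_cst.
  by apply/funext => y; rewrite big_nil.
rewrite (_ : (fun _ => _) = f i * (fun y => \prod_(i <- r) f i y)).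
  exact: differentiableM.
by apply/funext => y; rewrite big_cons.
Qed.

Lemma differentiable_det (V : normedModType R) p (f : V -> 'M[R]_p) x :
  (forall i j, differentiable (fun y => f y i j) x) ->
  differentiable (fun y => \det (f y)) x.
Proof.
move=> df; apply: differentiable_sum_fin => s.
rewrite (_ : (fun _ => _) = (-1) ^+ odd_perm s *: (fun y => \prod_i f y i (s i))) //.
by apply/differentiableZ/differentiable_prod_fin.
Qed.

Lemma unitmx_open : open [set X : M | X \is a GRing.unit].
Proof.
rewrite (_ : [set _ | _] = (fun X : M => \det X) @^-1` [set x | x != 0]).
  apply: open_comp; last exact: open_neq.
  move=> X _; apply: differentiable_continuous; apply: differentiable_det => i j.
  exact: differentiable_coord.
by apply/funext => X; rewrite /= -unitfE.
Qed.

(** The adjugate formula gives differentiability, and then the product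
rule applied to f f^-1 = 1 gives the value of the differential. *)
Lemma is_diff_invmx (V : normedModType R) (f df : V -> M) x :
  f x \is a GRing.unit -> is_diff x f df ->
  is_diff x (fun y => (f y)^-1) (fun v => - (f x)^-1 * df v * (f x)^-1).
Proof.
move=> fxu fx.
have unear : \forall y \near f x, y \is a GRing.unit.
  by apply: open_nbhs_nbhs; split => //; exact: unitmx_open.
have dinv : differentiable (fun y : M => y^-1) (f x).
  have dadj : differentiable (fun y : M => (\det y)^-1 *: \adj y) (f x).
    apply: differentiable_mx => i j.
    rewrite (_ : (fun _ => _) = (fun y : M => (\det y)^-1) * (fun y => cofactor y j i));
      last first.
      by apply/funext => y; rewrite !mxE.
    have cd p q (N : 'M[R]_(p, q)) k l := @differentiable_coord R p q N k l.
    apply: differentiableM.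
      apply: differentiableV; first by apply: differentiable_det.
      by move: fxu; rewrite -[_ \is a _]/(_ \in unitmx) unitmxE unitfE.
    rewrite /cofactor; apply: (@differentiableZ _ _ _ (fun y : M =>
      \det (row' j (col' i y)))).
    apply: differentiable_det => k l.
    rewrite (_ : (fun _ => _) = fun y : M => y (lift j k) (lift i l)) //.
    by apply/funext => y; rewrite !mxE.
  suff [] : is_diff (f x) (fun y : M => y^-1) ('d (fun y : M =>
    (\det y)^-1 *: \adj y) (f x)) by [].
  apply: (@near_is_diff _ _ _ _ (fun y : M => y^-1) _ _ _ (differentiableP dadj)).
  apply: filterS unear => y yu.
  by rewrite /GRing.inv /= /invmx -[y \in _]/(y \is a GRing.unit) yu.
have gd : differentiable (fun y => (f y)^-1) x.
  by apply: (@differentiable_comp _ _ _ _ f (fun y : M => y^-1)).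
apply: DiffDef => //; apply/funext => v.
have [fgd fgE] := is_diff_mulmx fx (differentiableP gd).
have fc : {for x, continuous f} by exact: differentiable_continuous.
have near1 : {near x, cst (1 : M) =1 (fun y => f y * (f y)^-1)}.
  have unearx : \forall y \near x, f y \is a GRing.unit by exact: (fc _ unear).
  by apply: filterS unearx => y yu; rewrite /= divrr.
have c1 := @diff_val _ _ _ _ _ _ _ (near_is_diff near1 (is_diff_cst (1 : M) x)).
have : df v * (f x)^-1 + f x * 'd (fun y => (f y)^-1) x v = 0.
  exact: (congr1 (@^~ v) (etrans (esym fgE) c1)).
move/eqP; rewrite addrC addr_eq0 => /eqP/(congr1 (fun Y => (f x)^-1 * Y)).
by rewrite mulKr // => ->; rewrite mulrN mulNr mulrA mulNr.
Qed.
End Square.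

Lemma linear_comb (R : pzRingType) (V W : lmodType R) (f : V -> W) (I : Type)
    (r : seq I) (P : pred I) (c : I -> R) (e : I -> V) : linear f ->
  f (\sum_(i <- r | P i) c i *: e i) = \sum_(i <- r | P i) c i *: f (e i).
Proof.
move=> lf; pose fL : {linear V -> W} := HB.pack f (GRing.isLinear.Build _ _ _ _ f lf).
by rewrite -[f]/(fL : _ -> _) linear_sum; apply: eq_bigr => i _; rewrite linearZ.
Qed.

Section Curves.
Context (R : realType).
Implicit Types s t : R.

Lemma is_diff_derive (V W : normedModType R) (f df : V -> W) x v :
  is_diff x f df -> is_derive x v f (df v).
Proof.
by case=> fd <-; apply: DeriveDef; [exact: diff_derivable|exact: deriveE].
Qed.

Lemma is_derive1_diff (W : normedModType R) (f : R -> W) t df :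
  is_derive t (1 : R) f df -> is_diff t f (fun h => h *: df).
Proof.
case=> fd fE; have fd' := (derivable1_diffP _ _).1 fd.
by apply: DiffDef => //; rewrite diff1E // derive1E fE.
Qed.

Lemma is_derive1_comp_curve (W : normedModType R) (f : R -> W) (g : R -> R) t df dg :
  is_derive (g t) (1 : R) f df -> is_derive t (1 : R) g dg ->
  is_derive t (1 : R) (fun s => f (g s)) (dg *: df).
Proof.
move=> /is_derive1_diff fd /is_derive1_diff gd.
by have := is_diff_derive (1 : R) (is_diff_comp gd fd); rewrite /= [1 *: dg]mul1r.
Qed.

Lemma is_derive1_linear_mx m n (W : normedModType R) (l : 'M[R]_(m, n) -> W)
    (f : R -> 'M[R]_(m, n)) t df :
  linear l -> is_derive t (1 : R) f df -> is_derive t (1 : R) (fun s => l (f s)) (l df).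
Proof.
move=> ll /is_derive1_diff fd.
by have := is_diff_derive (1 : R) (is_diff_linear_mx ll fd); rewrite scale1r.
Qed.

Lemma is_derive1_bilinear_mx m n p r (W : normedModType R)
    (l : 'M[R]_(m, n) -> 'M[R]_(p, r) -> W) f g t df dg :
  (forall y, linear (l^~ y)) -> (forall y, linear (l y)) ->
  is_derive t (1 : R) f df -> is_derive t (1 : R) g dg ->
  is_derive t (1 : R) (fun s => l (f s) (g s)) (l df (g t) + l (f t) dg).
Proof.
move=> l1 l2 /is_derive1_diff fd /is_derive1_diff gd.
by have := is_diff_derive (1 : R) (is_diff_bilinear_mx l1 l2 fd gd); rewrite !scale1r.
Qed.

Variable n : nat.
Local Notation M := 'M[R]_n.+1.
Implicit Types f g : R -> M.

Lemma is_derive1_mulmx f g t df dg :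
  is_derive t (1 : R) f df -> is_derive t (1 : R) g dg ->
  is_derive t (1 : R) (fun s => f s * g s) (df * g t + f t * dg).
Proof.
move=> /is_derive1_diff fd /is_derive1_diff gd.
by have := is_diff_derive (1 : R) (is_diff_mulmx fd gd); rewrite !scale1r.
Qed.

Lemma is_derive1_scale (h : R -> R) f t dh df :
  is_derive t (1 : R) h dh -> is_derive t (1 : R) f df ->
  is_derive t (1 : R) (fun s => h s *: f s) (dh *: f t + h t *: df).
Proof.
move=> /is_derive1_diff [hd hE] fd.
have h1 : is_derive t (1 : R) (fun s => h s *: (1 : M)) (dh *: 1).
  have k1 : is_diff t (fun s => h s *: (1 : M)) (fun r => (r *: dh) *: (1 : M)).
    by apply: DiffDef; [exact: differentiableZl|rewrite diffZl // hE].
  by have := is_diff_derive (1 : R) k1; rewrite scale1r.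
have := is_derive1_mulmx h1 fd; rewrite -!scalerAl !mul1r.
rewrite (_ : (fun s => _) = fun s => h s *: f s) //.
by apply/funext => s; rewrite -scalerAl mul1r.
Qed.

Lemma is_derive1_invmx f t df : f t \is a GRing.unit ->
  is_derive t (1 : R) f df ->
  is_derive t (1 : R) (fun s => (f s)^-1) (- (f t)^-1 * df * (f t)^-1).
Proof.
move=> fu /is_derive1_diff fd.
by have := is_diff_derive (1 : R) (is_diff_invmx fu fd); rewrite !scale1r.
Qed.

(** The uniqueness results on differential equations below all reduce to
this one, applied to a solution multiplied by an inverse flow. *)
Lemma is_derive1_cst_eq f : (forall t, is_derive t (1 : R) f 0) -> forall s t, f s = f t.
Proof.
move=> f0 s t; apply/matrixP => i j.
apply: (is_derive_0_is_cst (f := fun t => f t i j)) => x.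
have cl : linear (fun N : M => N i j : R) by move=> c u v; rewrite !mxE.
by have := is_derive1_linear_mx cl (f0 x); rewrite mxE.
Qed.

End Curves.

(** * Smooth functions *)

Section Smooth.
Context (R : realType).
Implicit Types s t : R.

Section General.
Context (V W : normedModType R).
Implicit Types (f g : V -> W) (U : set V).

Lemma CkS k U f : Ck k.+1 U f -> Ck k U f.
Proof.
elim: k f => [|k IH] f [df Df]; first by move=> x Ux; apply/differentiable_continuous/df.
by split=> // v; apply: IH; apply: Df.
Qed.

Lemma Ck_eq k U f g : open U -> (forall x, U x -> f x = g x) ->
  Ck k U f -> Ck k U g.
Proof.
move=> oU; have nU x : U x -> \forall y \near x, U y by move=> Ux; exact: open_nbhs_nbhs.
elim: k f g => [|k IH] f g fg.
  move=> cf x Ux; suff : g @ x --> f x by rewrite fg.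
  apply: cvg_trans (cf x Ux); apply: near_eq_cvg.
  by apply: filterS (nU x Ux) => y /fg.
have fgn x : U x -> {near x, f =1 g} by move=> Ux; apply: filterS (nU x Ux) => y /fg.
move=> [df Df]; split=> [x Ux|v].
  have [//] := near_is_diff (fgn x Ux) (differentiableP (df x Ux)).
by apply: IH (Df v) => x Ux; apply: near_eq_derive; apply: fgn.
Qed.

Lemma Ck_cst k U (w : W) : Ck k U (fun=> w).
Proof.
elim: k w => [|k IH] w; first by move=> x _; exact: cvg_cst.
split=> [x _|v]; first exact: differentiable_cst.
by rewrite (_ : 'D_v _ = fun=> 0) //; apply/funext => x; apply: derive_cst.
Qed.

(** Induction step for all the closure properties of Ck: the differential
only has to be known on U. *)
Lemma Ck_step k U f (df : V -> V -> W) : open U ->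
  (forall x, U x -> is_diff x f (df x)) -> (forall v, Ck k U (df^~ v)) ->
  Ck k.+1 U f.
Proof.
move=> oU fd Df; split=> [x /fd [//]|v].
apply: Ck_eq (Df v) => // x /fd h.
by have [_ ->] := is_diff_derive v h.
Qed.

Lemma Ck_is_diff k U f x : Ck k.+1 U f -> U x -> is_diff x f (fun v => 'D_v f x).
Proof.
move=> [df _] /df fd; apply: DiffDef => //.
by apply/funext => v; rewrite deriveE.
Qed.

Lemma Ck_derive k U f v : Ck k.+1 U f -> Ck k U ('D_v f).
Proof. by case=> _; apply. Qed.

Lemma Ck_add k U f g : open U -> Ck k U f -> Ck k U g -> Ck k U (fun x => f x + g x).
Proof.
move=> oU; elim: k f g => [|k IH] f g fk gk.
  by move=> x Ux; apply: cvgD; [exact: fk|exact: gk].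
apply: (Ck_step (df := fun x v => 'D_v f x + 'D_v g x)) => // [x Ux|v].
  exact: is_diffD (Ck_is_diff fk Ux) (Ck_is_diff gk Ux).
by apply: IH; exact: Ck_derive.
Qed.

Lemma Cinf_derive U f v : Cinf U f -> Cinf U ('D_v f).
Proof. by move=> fC k; exact/Ck_derive/fC. Qed.

End General.

Lemma Cinf_derive1 (W : normedModType R) (f : R -> W) :
  Cinf setT f -> Cinf setT (derive1 f).
Proof.
move=> fC; rewrite (_ : derive1 f = 'D_1 f); first exact: Cinf_derive.
by apply/funext => t; rewrite derive1E.
Qed.

Lemma Cinf_is_derive1 (W : normedModType R) (f : R -> W) t :
  Cinf setT f -> is_derive t (1 : R) f (derive1 f t).
Proof.
move=> fC; have := is_diff_derive (1 : R) (Ck_is_diff (fC 1%N) (I : setT t)).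
by rewrite derive1E.
Qed.

Section Mx.
Context (n : nat) (V : normedModType R).
Local Notation M := 'M[R]_n.+1.
Implicit Types (f g : V -> M) (U : set V).

Lemma Ck_linear (W : normedModType R) k U f (l : M -> W) : open U -> linear l ->
  Ck k U f -> Ck k U (fun x => l (f x)).
Proof.
move=> oU ll; elim: k f => [|k IH] f fk.
  by move=> x Ux; apply: continuous_comp; [exact: fk|exact: linear_mx_continuous].
apply: (Ck_step (df := fun x v => l ('D_v f x))) => // [x Ux|v].
  exact: is_diff_linear_mx ll (Ck_is_diff fk Ux).
by apply: IH; exact: Ck_derive.
Qed.

Lemma mulmx_cvg (T : Type) (F : set_system T) (FF : Filter F) (f g : T -> M) (a b : M) :
  f @ F --> a -> g @ F --> b -> (fun x => f x * g x) @ F --> a * b.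
Proof.
move=> fa gb.
rewrite (_ : (fun _ => _) = (fun p : M * M => p.1 * p.2) \o (fun x => (f x, g x))) //.
apply: cvg_comp; first exact: cvg_pair fa gb.
apply: (@differentiable_continuous _ _ _ (a, b) (fun p : M * M => p.1 * p.2)).
have d1 : is_diff (a, b) (fst : M * M -> M) fst.
  have cfst : continuous (fst : M * M -> M) by move=> ?; exact: cvg_fst.
  by apply: DiffDef; [exact: linear_differentiable|rewrite diff_lin].
have d2 : is_diff (a, b) (snd : M * M -> M) snd.
  have csnd : continuous (snd : M * M -> M) by move=> ?; exact: cvg_snd.
  by apply: DiffDef; [exact: linear_differentiable|rewrite diff_lin].
by have [] := is_diff_mulmx d1 d2.
Qed.

Lemma Ck_mul k U f g : open U -> Ck k U f -> Ck k U g -> Ck k U (fun x => f x * g x).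
Proof.
move=> oU; elim: k f g => [|k IH] f g fk gk.
  by move=> x Ux; apply: mulmx_cvg; [exact: fk|exact: gk].
apply: (Ck_step (df := fun x v => 'D_v f x * g x + f x * 'D_v g x)) => // [x Ux|v].
  exact: is_diff_mulmx (Ck_is_diff fk Ux) (Ck_is_diff gk Ux).
apply: Ck_add => //; apply: IH; do ?[exact: CkS]; by exact: Ck_derive.
Qed.

Lemma Ck_scale1 k U (h : V -> R) : open U -> Ck k U h ->
  Ck k U (fun x => h x *: (1 : M)).
Proof.
move=> oU; elim: k h => [|k IH] h hk.
  by move=> x Ux; apply: cvgZr_tmp; exact: hk.
apply: (Ck_step (df := fun x v => 'D_v h x *: (1 : M))) => // [x Ux|v].
  have [hd hE] := Ck_is_diff hk Ux.
  by apply: DiffDef; [exact: differentiableZl|rewrite diffZl // hE].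
by apply: IH; exact: Ck_derive.
Qed.

Lemma Ck_scale k U (h : V -> R) f : open U -> Ck k U h -> Ck k U f ->
  Ck k U (fun x => h x *: f x).
Proof.
move=> oU hk fk; have := Ck_mul oU (Ck_scale1 oU hk) fk.
by apply: (Ck_eq oU) => x _; rewrite -scalerAl mul1r.
Qed.

Lemma Ck_inv k U f : open U -> (forall x, U x -> f x \is a GRing.unit) ->
  Ck k U f -> Ck k U (fun x => (f x)^-1).
Proof.
move=> oU fu; elim: k f fu => [|k IH] f fu fk.
  move=> x Ux; apply: (continuous_comp (g := fun y : M => y^-1)); first exact: fk.
  apply: (@differentiable_continuous _ _ _ (f x) (fun y : M => y^-1)).
  have di : is_diff (f x) (@id M) id by exact: is_diff_id.
  by have [] := is_diff_invmx (fu x Ux) di.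
apply: (Ck_step (df := fun x v => - (f x)^-1 * 'D_v f x * (f x)^-1)) => // [x Ux|v].
  exact: is_diff_invmx (fu x Ux) (Ck_is_diff fk Ux).
have ik : Ck k U (fun x => (f x)^-1) by apply: IH => //; exact: CkS.
apply: Ck_mul => //; apply: Ck_mul => //; last exact: Ck_derive.
by apply: (Ck_linear (l := -%R)) => // c a b; rewrite opprD scalerN.
Qed.

End Mx.

Lemma Cinf_id n U : Cinf U (@id 'M[R]_n.+1).
Proof.
move=> [|k]; first by move=> x _; exact: cvg_id.
split=> [x _|v]; first exact: ex_diff.
rewrite (_ : 'D_v id = fun=> v); first exact: Ck_cst.
by apply/funext => x; exact: derive_id.
Qed.

(** Solutions of linear equations are smooth, each derivative being a
linear function of the solution. *)
Lemma Cinf_ode n (f : R -> 'M[R]_n.+1) l : linear l ->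
  (forall t, is_derive t (1 : R) f (l (f t))) -> Cinf setT f.
Proof.
move=> ll fd k; elim: k => [|k IH].
  by move=> t _; apply/differentiable_continuous/derivable1_diffP; case: (fd t).
apply: (@Ck_step R 'M[R]_n.+1 k setT f (fun x v : R => v *: l (f x))).
  exact: openT.
  by move=> t _; exact: is_derive1_diff.
move=> v; apply: (Ck_linear (l := fun y => v *: l y)) => //; first exact: openT.
by move=> c a b; rewrite ll scalerDr !scalerA mulrC.
Qed.

End Smooth.

(** * Flows of linear operators *)

Section Exponentials.
Context (R : realType) (n : nat).
Local Notation M := 'M[R]_n.+1.
Implicit Types s t : R.

Lemma normr_entry_le (x : M) i j : `|x i j| <= `|x|.
Proof.
rewrite [leRHS]/Num.Def.normr/= mx_normrE.
exact: (le_bigmax _ (fun ij : 'I_n.+1 * 'I_n.+1 => `|x ij.1 ij.2|) (i, j)).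
Qed.

Lemma is_derive1_sum (W : normedModType R) (I : Type) (r : seq I) (f : I -> R -> W)
    (df : I -> W) t :
  (forall i, is_derive t (1 : R) (f i) (df i)) ->
  is_derive t (1 : R) (fun s => \sum_(i <- r) f i s) (\sum_(i <- r) df i).
Proof.
move=> fd; elim: r => [|i r IH].
  rewrite big_nil (_ : (fun _ => _) = cst 0); first exact: is_derive_cst.
  by apply/funext => s; rewrite big_nil.
rewrite big_cons (_ : (fun _ => _) = f i + (fun s => \sum_(i <- r) f i s)).
  exact: is_deriveD.
by apply/funext => s; rewrite big_cons.
Qed.

(** The exponential series only involves the iterates of the starting
point, so that operators that agree on an invariant set have the same
exponentials there. This replaces the transport operator of the theorem, whose
values outside the Lie algebra are arbitrary, by a linear one. *)
Lemma eq_expv_in (P : M -> Prop) (F F' : M -> M) v :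
  P v -> (forall x, P x -> P (F' x)) -> (forall x, P x -> F x = F' x) ->
  expv F v = expv F' v.
Proof.
move=> Pv PF FF'.
have it j : iter j F v = iter j F' v /\ P (iter j F' v).
  elim: j => // j [IH Pj]; rewrite !iterS IH; split; [exact: FF'|exact: PF].
rewrite /expv; suff -> : (fun j => j`!%:R^-1 *: iter j F v) =
  (fun j => j`!%:R^-1 *: iter j F' v) by [].
by apply/funext => j; have [-> _] := it j.
Qed.

Section Flow.
Variable L : M -> M.
Hypothesis lL : linear L.
Implicit Types u v w : M.

Let coef v i j (k : nat) : R := k`!%:R^-1 * iter k L v i j.

Let LZ c u : L (c *: u) = c *: L u.
Proof.
have L0 : L 0 = 0 by have := lL (-1) 0 0; rewrite scaler0 addr0 scaleN1r addNr.
by rewrite -[c *: u]addr0 lL L0 addr0.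
Qed.

Let iterZ t k v : iter k (fun x => t *: L x) v = t ^+ k *: iter k L v.
Proof.
elim: k => [|k IH]; first by rewrite expr0 scale1r.
by rewrite !iterS IH LZ scalerA exprS.
Qed.

Let iter_bound : exists2 C : R, 0 < C & forall k v, `|iter k L v| <= C ^+ k * `|v|.
Proof.
pose Ll : {linear M -> M} := HB.pack L (GRing.isLinear.Build _ _ _ _ L lL).
have [C C0 LC] := linear_lipschitz (f := Ll) (linear_mx_continuous lL).
exists C => // k v; elim: k => [|k IH]; first by rewrite expr0 mul1r.
rewrite iterS; apply: le_trans (LC _) _.
by rewrite exprS -mulrA ler_pM2l.
Qed.

Let coef_cvg v i j x : cvgn (pseries (coef v i j) x).
Proof.
have [C C0 CL] := iter_bound.
apply: normed_cvg.
apply: (@series_le_cvg _ _ (fun k => `|v| *: exp_coeff (C * `|x|) k)) => [k|k|k|].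
- exact: normr_ge0.
- by rewrite mulr_ge0 // exp_coeff_ge0 // mulr_ge0 // ltW.
- have vb : `|iter k L v i j| <= C ^+ k * `|v|.
    exact: le_trans (normr_entry_le _ _ _) (CL _ _).
  have -> : `|v| *: exp_coeff (C * `|x|) k =
      k`!%:R^-1 * (C ^+ k * `|v|) * `|x| ^+ k.
    by rewrite /exp_coeff /= exprMn /GRing.scale /=; ring.
  rewrite /= /coef !normrM normfV normr_nat normrX.
  by rewrite ler_wpM2r ?exprn_ge0 // ler_wpM2l ?invr_ge0.
- by apply: is_cvg_seriesZ; exact: is_cvg_series_exp_coeff.
Qed.

Let coef_diffs v i j : pseries_diffs (coef v i j) = coef (L v) i j.
Proof.
apply/funext => k; rewrite /pseries_diffs /coef -iterSr factS natrM invfM mulrA mulVKf //.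
Qed.

Let expvS t v N : series (fun k => k`!%:R^-1 *: iter k (fun x => t *: L x) v) N =
  \sum_i \sum_j pseries (coef v i j) t N *: delta_mx i j.
Proof.
rewrite {1}[LHS]matrix_sum_delta; apply: eq_bigr => i _; apply: eq_bigr => j _.
congr (_ *: _); rewrite /pseries /series /= summxE; apply: eq_bigr => k _.
by rewrite iterZ !mxE /coef mulrCA mulrC.
Qed.

Let flow v t : M := \matrix_(i, j) limn (pseries (coef v i j) t).

Let flow_cvg t v :
  series (fun k => k`!%:R^-1 *: iter k (fun x => t *: L x) v) @ \oo --> flow v t.
Proof.
rewrite (_ : series _ = fun N => \sum_i \sum_j pseries (coef v i j) t N *: delta_mx i j).
  rewrite [flow v t]matrix_sum_delta; do 2 apply: cvg_sum_fin => ?.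
  by rewrite mxE; apply: cvgZr_tmp; exact: coef_cvg.
by apply/funext => N; exact: expvS.
Qed.

Let expvE t v : expv (fun x => t *: L x) v = flow v t.
Proof. exact/cvg_lim/flow_cvg. Qed.

Lemma expv_cvg t v :
  series (fun k => k`!%:R^-1 *: iter k (fun x => t *: L x) v) @ \oo -->
  expv (fun x => t *: L x) v.
Proof. by rewrite expvE; exact: flow_cvg. Qed.

(** Each entry of the series is a real power series in t, to which
termwise differentiation applies. *)
Lemma is_derive_expv v t :
  is_derive t (1 : R) (fun s => expv (fun x => s *: L x) v)
    (expv (fun x => t *: L x) (L v)).
Proof.
have entry w s i j : expv (fun x => s *: L x) w i j = limn (pseries (coef w i j) s).
  by rewrite expvE mxE.
have ed i j : is_derive t (1 : R) (fun s => expv (fun x => s *: L x) v i j)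
    (expv (fun x => t *: L x) (L v) i j).
  rewrite (_ : (fun s => _) = fun s => limn (pseries (coef v i j) s)); last first.
    by apply/funext => s; exact: entry.
  rewrite entry -coef_diffs.
  apply: (pseries_snd_diffs (K := `|t| + 1)); rewrite ?coef_diffs; try exact: coef_cvg.
  by rewrite [ltRHS]ger0_norm ?addr_ge0 // ltrDl.
have fd : derivable (fun s => expv (fun x => s *: L x) v) t 1.
  by apply/derivable_mxP => i j; case: (ed i j).
apply: DeriveDef => //; rewrite derive_mx //; apply/matrixP => i j.
by rewrite mxE; case: (ed i j).
Qed.

Lemma expv_linear t : linear (expv (fun x => t *: L x)).
Proof.
move=> c u v; apply: cvg_lim => //.
have iL k : iter k (fun x => t *: L x) (c *: u + v) =
    c *: iter k (fun x => t *: L x) u + iter k (fun x => t *: L x) v.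
  elim: k => [//|k IH]; rewrite !iterS IH lL scalerDr !scalerA.
  by rewrite [t * c]mulrC.
pose S w := series (fun k => k`!%:R^-1 *: iter k (fun x => t *: L x) w) : nat -> M.
rewrite -/(S _) (_ : S _ = (c \*: S u) + S v).
  by apply: cvgD; [apply: cvgZl_tmp|]; exact: expv_cvg.
apply/funext => N; rewrite !fctE /S /series /= scaler_sumr -big_split /=.
by apply: eq_bigr => k _; rewrite iL scalerDr !scalerA mulrC.
Qed.

Lemma expv_comm t v :
  expv (fun x => t *: L x) (L v) = L (expv (fun x => t *: L x) v).
Proof.
apply: cvg_lim => //.
pose Ll : {linear M -> M} := HB.pack L (GRing.isLinear.Build _ _ _ _ L lL).
pose S w := series (fun k => k`!%:R^-1 *: iter k (fun x => t *: L x) w) : nat -> M.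
rewrite -/(S _) (_ : S _ = L \o S v).
  by apply: continuous_cvg; [exact: linear_mx_continuous|exact: expv_cvg].
apply/funext => N; rewrite -[RHS]/(Ll (S v N)) /S /series linear_sum.
by apply: eq_bigr => k _; rewrite linearZ /= !iterZ LZ -iterSr -iterS.
Qed.

(** If p is a linear projection, this says that the flow preserves its
image when all the iterates of L lie in it. *)
Lemma expv_fix (p : M -> M) t v : linear p ->
  (forall k, p (iter k (fun x => t *: L x) v) = iter k (fun x => t *: L x) v) ->
  p (expv (fun x => t *: L x) v) = expv (fun x => t *: L x) v.
Proof.
move=> lp pv; apply/esym/cvg_lim => //.
pose S := series (fun k => k`!%:R^-1 *: iter k (fun x => t *: L x) v) : nat -> M.
rewrite -/S (_ : S = p \o S).
  by apply: continuous_cvg; [exact: linear_mx_continuous|exact: expv_cvg].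
apply/funext => N; rewrite /S /series /= (linear_comb _ _ _ _ lp).
by apply: eq_bigr => k _; rewrite pv.
Qed.

Lemma expv0 v : expv (fun x => 0 *: L x) v = v.
Proof.
apply: cvg_lim => //; rewrite -cvg_shiftS.
rewrite (_ : (fun _ => _) = cst v); first exact: cvg_cst.
apply/funext => N; rewrite /series /= big_nat_recl //= fact0 invr1 scale1r.
by rewrite big1 ?addr0 // => k _; rewrite scale0r scaler0.
Qed.

Lemma is_derive_expvL v t :
  is_derive t (1 : R) (fun s => expv (fun x => s *: L x) v)
    (L (expv (fun x => t *: L x) v)).
Proof. by rewrite -expv_comm; exact: is_derive_expv. Qed.

(** The derivative of s |-> exp ((t1 - s) L) (w s) vanishes; its values at
0 and t1 are the two sides. *)
Lemma expv_unique (w : R -> M) :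
  (forall t, is_derive t (1 : R) w (L (w t))) ->
  forall t, w t = expv (fun x => t *: L x) (w 0).
Proof.
move=> wd t1.
pose h s := expv (fun x => (t1 - s) *: L x) (w s).
have hd s : is_derive s (1 : R) h 0.
  pose E i j s := expv (fun x => (t1 - s) *: L x) (delta_mx i j) : M.
  have hE r : h r = \sum_i \sum_j w r i j *: E i j r.
    exact: (linear_mxE (expv_linear (t1 - r))).
  have Ed i j r : is_derive r (1 : R) (E i j)
      (-1 *: expv (fun x => (t1 - r) *: L x) (L (delta_mx i j))).
    apply: (is_derive1_comp_curve (f := fun r => expv (fun x => r *: L x) (delta_mx i j))).
      exact: is_derive_expv.
    by rewrite -[X in is_derive _ _ _ X]sub0r; exact: is_deriveB.
  have sd : is_derive s (1 : R) h (\sum_i \sum_j (L (w s) i j *: E i j s +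
      w s i j *: (-1 *: expv (fun x => (t1 - s) *: L x) (L (delta_mx i j))))).
    rewrite (_ : h = fun r => \sum_i \sum_j w r i j *: E i j r); last first.
      by apply/funext => r; exact: hE.
    do 2 apply: is_derive1_sum => ?.
    apply: (is_derive1_bilinear_mx (l := fun x y : M => x _ _ *: y)) => //.
      by move=> y c u v; rewrite !mxE scalerDl scalerA.
    by move=> y c u v; rewrite scalerDr !scalerA mulrC.
  rewrite (_ : 0 = \sum_i \sum_j (L (w s) i j *: E i j s +
      w s i j *: (-1 *: expv (fun x => (t1 - s) *: L x) (L (delta_mx i j))))) //.
  have lEL : linear (fun x => expv (fun x => (t1 - s) *: L x) (L x)).
    by move=> c u v; rewrite lL expv_linear.
  transitivity (expv (fun x => (t1 - s) *: L x) (L (w s)) -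
                expv (fun x => (t1 - s) *: L x) (L (w s))); first by rewrite subrr.
  rewrite [X in X - _](linear_mxE (expv_linear (t1 - s))) [X in _ - X](linear_mxE lEL).
  rewrite -sumrB; apply: eq_bigr => i _; rewrite -sumrB; apply: eq_bigr => j _.
  by rewrite scaleN1r scalerN.
have := is_derive1_cst_eq hd t1 0.
by rewrite /h subrr subr0 expv0.
Qed.
End Flow.
End Exponentials.

(** * The matrix exponential *)

Section Expm.
Context (R : realType) (n : nat).
Local Notation M := 'M[R]_n.+1.
Implicit Types (s t : R) (A C X : M).

Lemma linear_mull A : linear (fun x : M => A * x).
Proof. by move=> c u v; rewrite mulrDr scalerAr. Qed.

Lemma linear_mulr A : linear (fun x : M => x * A).
Proof. by move=> c u v; rewrite mulrDl scalerAl. Qed.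

Lemma expmE t A : expm (t *: A) = expv (fun x => t *: (A * x)) 1.
Proof.
rewrite /expm /expv.
suff -> : (fun k => k`!%:R^-1 *: (t *: A) ^+ k) =
    (fun k => k`!%:R^-1 *: iter k (fun x => t *: (A * x)) 1) by [].
apply/funext => k; congr (_ *: _).
by elim: k => [//|k IH]; rewrite iterS -IH exprS scalerAl.
Qed.

Lemma expm_scale0 A : expm (0 *: A) = 1.
Proof. by rewrite expmE; exact: (expv0 (fun x => A * x) 1). Qed.

Lemma is_derive_expm A t :
  is_derive t (1 : R) (fun s => expm (s *: A)) (A * expm (t *: A)).
Proof.
rewrite expmE (_ : (fun s => _) = fun s => expv (fun x => s *: (A * x)) 1).
  exact: (is_derive_expvL (linear_mull A) 1 t).
by apply/funext => s; exact: expmE.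
Qed.

Lemma mull_ode A (Y : R -> M) :
  (forall t, is_derive t (1 : R) Y (A * Y t)) -> forall t, Y t = expm (t *: A) * Y 0.
Proof.
move=> Yd t; rewrite (expv_unique (linear_mull A) Yd).
pose Z t := expm (t *: A) * Y 0.
have Zd s : is_derive s (1 : R) Z (A * Z s).
  rewrite mulrA; exact: (is_derive1_linear_mx (linear_mulr (Y 0)) (is_derive_expm A s)).
by rewrite -/(Z t) (expv_unique (linear_mull A) Zd) /Z expm_scale0 mul1r.
Qed.

Lemma expm_comm A C t : A * C = C * A -> expm (t *: A) * C = C * expm (t *: A).
Proof.
move=> AC.
have d s : is_derive s (1 : R) (fun s => C * expm (s *: A)) (A * (C * expm (s *: A))).
  rewrite mulrA AC -mulrA.
  exact: (is_derive1_linear_mx (linear_mull C) (is_derive_expm A s)).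
by rewrite (mull_ode d t) expm_scale0 mulr1.
Qed.

Lemma is_derive_expmr A t :
  is_derive t (1 : R) (fun s => expm (s *: A)) (expm (t *: A) * A).
Proof. by rewrite (expm_comm (C := A)) //; exact: is_derive_expm. Qed.

Lemma expmVl t A : expm (t *: - A) * expm (t *: A) = 1.
Proof.
have H s : is_derive s (1 : R) (fun r => expm (r *: - A) * expm (r *: A)) 0.
  have := is_derive1_mulmx (is_derive_expmr (- A) s) (is_derive_expm A s).
  by rewrite mulrN mulNr !mulrA addNr.
by rewrite (is_derive1_cst_eq H t 0) !expm_scale0 mulr1.
Qed.

Lemma expmVr t A : expm (t *: A) * expm (t *: - A) = 1.
Proof. by have := expmVl t (- A); rewrite opprK. Qed.

Lemma expm_unit A : expm A \is a GRing.unit.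
Proof.
have := expmVr 1 A; have := expmVl 1 A; rewrite !scale1r => h1 h2.
by apply/unitrP; exists (expm (- A)).
Qed.

Lemma expm_inv t A : (expm (t *: A))^-1 = expm (t *: - A).
Proof. by apply: (mulrI (expm_unit (t *: A))); rewrite divrr ?expm_unit // expmVr. Qed.

Lemma mulr_ode A (Y : R -> M) :
  (forall t, is_derive t (1 : R) Y (Y t * A)) -> forall t, Y t = Y 0 * expm (t *: A).
Proof.
move=> Yd t; apply: (mulIr (expm_unit (t *: - A))); rewrite -mulrA expmVr mulr1.
have H s : is_derive s (1 : R) (fun r => Y r * expm (r *: - A)) 0.
  have := is_derive1_mulmx (Yd s) (is_derive_expm (- A) s).
  by rewrite mulNr mulrN -!mulrA subrr.
by rewrite (is_derive1_cst_eq H t 0) expm_scale0 mulr1.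
Qed.

Lemma expm_conj X A t : X \is a GRing.unit ->
  expm (t *: (X * A * X^-1)) = X * expm (t *: A) * X^-1.
Proof.
move=> Xu.
have l : linear (fun x : M => X * x * X^-1).
  by move=> c u v; rewrite mulrDr mulrDl -scalerAr -scalerAl.
have d s : is_derive s (1 : R) (fun s => X * expm (s *: A) * X^-1)
    (X * A * X^-1 * (X * expm (s *: A) * X^-1)).
  rewrite !mulrA mulrVK // -[X * A * _]mulrA.
  exact: (is_derive1_linear_mx l (is_derive_expm A s)).
by rewrite (mull_ode d t) expm_scale0 mulr1 divrr // mulr1.
Qed.

Lemma is_derive_Ad S (v : R -> M) t dv :
  is_derive t (1 : R) v dv ->
  is_derive t (1 : R) (fun s => expm (s *: S) * v s * expm (s *: - S))
    (expm (t *: S) * (dv + lie_bracket S (v t)) * expm (t *: - S)).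
Proof.
move=> vd.
have := is_derive1_mulmx (is_derive1_mulmx (is_derive_expmr S t) vd) (is_derive_expm
  (- S) t).
rewrite (_ : _ + _ * _ = expm (t *: S) * (dv + lie_bracket S (v t)) * expm (t *: - S)) //.
rewrite /lie_bracket !(mulrDl, mulrDr, mulrBl, mulrBr, mulrN, mulNr) !mulrA addrAC -addrA addrC
  .
by rewrite -!addrA addrC -!addrA.
Qed.

End Expm.

(** * Curves and fields on a matrix Lie group *)

Section Manifold.
Context (R : realType) (n : nat).
Local Notation M := 'M[R]_n.+1.
Implicit Types (s t : R) (G : set M) (g : {vspace M}).

Lemma smooth_curveD G g c t : smooth_curve G g c -> is_derive t (1 : R) c (derive1 c t).
Proof. by case=> cC _; exact: Cinf_is_derive1. Qed.

Lemma is_derive_affine (a d r : R) : is_derive r (1 : R) (fun s => a + d * s) d.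
Proof.
have := is_deriveD (is_derive_cst a r (1 : R)) (is_deriveZ d (is_derive_id r (1 : R))).
by rewrite add0r [_ *: 1]mulr1.
Qed.

(** Reparametrised curves occur in the definition of the balls of the
left-invariant distance. *)
Lemma Ck_affine k (f : R -> M) (a d : R) : Ck k setT f -> Ck k setT (fun r =>
  f (a + d * r)).
Proof.
elim: k f => [|k IH] f fk.
  move=> r _; apply: continuous_comp; last exact: fk.
  by apply/differentiable_continuous/derivable1_diffP; case: (is_derive_affine a d r).
apply: (@Ck_step R R M k setT _ (fun x v : R => v *: (d *: 'D_1 f (a + d * x)))).
- exact: openT.
- move=> x _; apply: is_derive1_diff.
  apply: (is_derive1_comp_curve (f := f)); last exact: is_derive_affine.
  exact: (is_diff_derive (1 : R) (Ck_is_diff fk (I : setT (a + d * x)))).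
move=> v; have := IH _ (Ck_derive (1 : R) fk).
by apply: (Ck_linear (l := fun y => v *: (d *: y)) openT) => c x y;
  rewrite !scalerDr !scalerA; congr (_ *: _ + _); ring.
Qed.

Lemma smooth_curve_affine G g c (a d : R) : smooth_curve G g c ->
  smooth_curve G g (fun r => c (a + d * r)) /\
  forall r, derive1 (fun r => c (a + d * r)) r = d *: derive1 c (a + d * r).
Proof.
move=> [cC cG].
have cd r : derive1 (fun r => c (a + d * r)) r = d *: derive1 c (a + d * r).
  rewrite derive1E.
  have := is_derive1_comp_curve (f := c) (g := fun s => a + d * s) (t := r)
    (Cinf_is_derive1 _ cC).
  by move=> /(_ _ (is_derive_affine a d r)) [].
split; last exact: cd.
split=> [k|r]; first by apply: Ck_affine; exact: cC.
have [? ?] := cG (a + d * r).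
by rewrite cd -scalerAr; split => //; exact: memvZ.
Qed.

(** A smooth curve of G is continuous for the manifold topology: the piece
of c between t and s, run in unit time, has left velocity |s - t| times that
of c, which is bounded near t. *)
Lemma near_lie_ball G g c t (e : R) : smooth_curve G g c ->
  (forall X, G X -> X \is a GRing.unit) -> 0 < e ->
  \forall s \near t, lie_ball G g (c t) e (c s).
Proof.
move=> csm Gu e0; have [cC cG] := csm.
pose u s := (c s)^-1 * derive1 c s.
have uc : {for t, continuous u}.
  apply: mulmx_cvg.
    have := @Ck_inv R n R 0 setT c openT (fun s _ => Gu _ (cG s).1) (cC 0%N).
    exact.
  exact: (Cinf_derive1 cC 0%N).
pose K := `|u t| + 1.
have K0 : 0 < K by rewrite ltr_wpDl.
have : \forall s \near t, `|u s| < K.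
  have : (fun s => `|u s|) @ t --> `|u t| by exact: cvg_norm.
  move/cvgr_lt; apply; by rewrite ltrDl.
move=> /nbhs_ballP[d d0 dK].
apply/nbhs_ballP; exists (Num.min d (e / K)); first by rewrite /= lt_min d0 divr_gt0.
move=> s; rewrite -ball_normE /= lt_min => /andP[ds eK].
have [cs cd] := smooth_curve_affine t (s - t) csm.
exists (fun r => c (t + (s - t) * r)); split => //.
- by rewrite mulr0 addr0.
- by rewrite mulr1 addrC subrK.
move=> r /andP[r0 r1]; rewrite cd -scalerAr normrZ -/(u _).
have uK : `|u (t + (s - t) * r)| < K.
  apply: dK; rewrite -ball_normE /= opprD addNKr normrN normrM (ger0_norm r0).
  by rewrite (le_lt_trans _ ds) // distrC ler_piMr.
rewrite distrC in eK.
apply: le_lt_trans (_ : `|s - t| * K < e); last by rewrite -ltr_pdivlMr.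
by rewrite ler_wpM2l // ltW.
Qed.

Section Fields.
Variables (G : set M) (g : {vspace M}).
Hypothesis Gsub : is_subgroup_GL G.
Hypothesis Glie : is_lie_algebra_of G g.

Lemma G_unit X : G X -> X \is a GRing.unit.
Proof. by case: Gsub => _ _ /[apply] -[]. Qed.

Lemma smooth_exp_curve X V : G X -> V \in g ->
  smooth_curve G g (fun t => X * expm (t *: V)) /\
  forall t, is_derive t (1 : R) (fun t => X * expm (t *: V)) (X * expm (t *: V) * V).
Proof.
move=> GX gV.
have cd t : is_derive t (1 : R) (fun t => X * expm (t *: V)) (X * expm (t *: V) * V).
  by rewrite -mulrA; exact: (is_derive1_linear_mx (linear_mull X) (is_derive_expmr V t)).
have [_ Gm _] := Gsub.
have GXV t : G (X * expm (t *: V)) by apply: Gm => //; exact: (Glie V).1.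
split=> //; split=> [|t]; first exact: (Cinf_ode (linear_mulr V) cd).
split=> //; rewrite derive1E; have [_ ->] := cd t.
by rewrite mulKr //; apply: G_unit.
Qed.

(** Chain rule. Near t the curve stays in the ball where f coincides with
a smooth function F of matrices, so that the derivative is that of F, as it is
on the exponential curve used by [dirD]. *)
Lemma is_derive_dirD (W : normedModType R) (f : M -> W) c t :
  smooth_on G g f -> smooth_curve G g c ->
  is_derive t (1 : R) (fun s => f (c s)) (dirD f (c t) (derive1 c t)).
Proof.
move=> fs csm; have [cC cG] := csm; have [Gct gct] := cG t.
have [U [F [e [oU Uc FC e0 fF]]]] := fs _ Gct.
have key (c' : R -> M) t' : smooth_curve G g c' -> c' t' = c t ->
    is_derive t' (1 : R) (fun s => f (c' s)) ('d F (c t) (derive1 c' t')).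
  move=> c'sm c't.
  have dc' := smooth_curveD t' c'sm.
  have Fd : is_diff (c t) F ('d F (c t)).
    by apply: differentiableP; have [+ _] := FC 1%N; apply.
  have Fc : is_derive t' (1 : R) (fun s => F (c' s)) ('d F (c t) (derive1 c' t')).
    rewrite -c't in Fd.
    have := is_diff_derive (1 : R) (is_diff_comp (is_derive1_diff dc') Fd).
    by rewrite /= scale1r c't.
  apply: near_eq_is_derive Fc.
  have nb := near_lie_ball t' c'sm G_unit e0.
  have nU : \forall s \near t', U (c' s).
    have cc : {for t', continuous c'}.
      by apply/differentiable_continuous/derivable1_diffP; case: dc'.
    by apply: cc; rewrite c't; exact: open_nbhs_nbhs.
  by apply: filterS2 nb nU => s; rewrite c't => /fF /[apply].
have := key c t csm erefl.
suff -> : dirD f (c t) (derive1 c t) = 'd F (c t) (derive1 c t) by [].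
have [xsm xd] := smooth_exp_curve Gct gct.
have x0 : c t * expm (0 *: ((c t)^-1 * derive1 c t)) = c t.
  by rewrite expm_scale0 mulr1.
rewrite /dirD derive1E; have [_ ->] := key _ 0 xsm x0.
rewrite derive1E; have [_ ->] := xd 0.
by rewrite x0 mulVKr //; exact: G_unit.
Qed.

Definition ltriv (Z : M -> M) (X : M) := X^-1 * Z X.

(** The derivative along xi of the left trivialisation of Z, by the product
rule. *)
Definition dltriv (Z : M -> M) (X xi : M) := X^-1 * dirD Z X xi - X^-1 * xi * ltriv Z X.

Lemma is_derive_ltriv Z c t : smooth_on G g Z -> smooth_curve G g c ->
  is_derive t (1 : R) (fun s => ltriv Z (c s)) (dltriv Z (c t) (derive1 c t)).
Proof.
move=> Zs csm; have [_ cG] := csm; have cu := G_unit (cG t).1.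
have := is_derive1_mulmx (is_derive1_invmx cu (smooth_curveD t csm))
  (is_derive_dirD t Zs csm).
rewrite (_ : _ + _ * _ = dltriv Z (c t) (derive1 c t)) //.
by rewrite /dltriv /ltriv addrC !mulNr !mulrA.
Qed.

Lemma Cinf_smooth_on (W : normedModType R) (f : M -> W) :
  Cinf [set X : M | X \is a GRing.unit] f -> smooth_on G g f.
Proof.
move=> fC X GX; exists [set X : M | X \is a GRing.unit], f, 1.
by split => //; [exact: unitmx_open|exact: G_unit].
Qed.

(** A linear projection onto U is the identity along the curve, hence on
its derivative. *)
Lemma derive_memv (U : {vspace M}) (c : R -> M) t dc :
  (forall s, c s \in U) -> is_derive t (1 : R) c dc -> dc \in U.
Proof.
move=> cU cd; have l : linear (projv U : M -> M) by move=> k u v; rewrite linearP.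
have := is_derive1_linear_mx l cd.
rewrite (_ : (fun s => _) = c); last first.
  by apply/funext => s; rewrite projv_id.
by case: cd => _ <- [_ ->]; exact: memv_proj.
Qed.

Lemma Ad_mem X V : G X -> V \in g -> X * V * X^-1 \in g.
Proof.
move=> GX gV; have [_ Gm Gi] := Gsub; have [Xu GXi] := Gi _ GX.
apply/Glie => t; rewrite expm_conj //.
by apply: (Gm) => //; apply: Gm => //; apply: (Glie V).1.
Qed.

End Fields.
End Manifold.

(** * The Koszul formula in a metric Lie algebra *)

Section MetricLieAlgebra.
Context (R : realType) (V : lmodType R).
Context (br : V -> V -> V) (f q : V -> V -> R) (T Pm : V -> V) (g m : V -> Prop).
Context (beta0 : R).
Context (brC : forall x y, br x y = - br y x)
  (brDl : forall x y z, br (x + y) z = br x z + br y z)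
  (brNl : forall x z, br (- x) z = - br x z)
  (fC : forall x y, f x y = f y x)
  (fDl : forall x y z, f (x + y) z = f x z + f y z)
  (fZl : forall c x z, f (c *: x) z = c * f x z)
  (gB : forall x y, g x -> g y -> g (x - y))
  (g_br : forall x y, g x -> g y -> g (br x y))
  (f_ad : forall x y z, g x -> g y -> g z -> f (br z x) y = - f x (br z y))
  (m_sub_g : forall x, m x -> g x)
  (mD : forall x y, m x -> m y -> m (x + y))
  (mZ : forall c x, m x -> m (c *: x))
  (TD : forall x y, T (x + y) = T x + T y)
  (T_adj : forall x y, f (T x) y = f x (T y))
  (T_m : forall x, m (T x))
  (T_br : forall x y, m y -> T (br (T x) y) = br (T x) (T y))
  (m_br : forall x y, m y -> m (br (T x) y))
  (Pm_m : forall x, m (Pm x))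
  (f_Pm : forall x y, m y -> f (Pm x) y = f x y)
  (qE : forall x y, g x -> g y -> q x y = beta0 * f (x - T x) y).

(** The operator P_v of the parallel transport. *)
Definition transport_op v x := 2^-1 *: (Pm (br x v) + br (T v) x - br (T x) v).

(** What must be added to the derivative of the trivialised field to
obtain the trivialised horizontal connection. *)
Definition christoffel u v := 2^-1 *: (Pm (br u v) + (br (T u) v + br (T v) u)).

Let mB x y : m x -> m y -> m (x - y).
Proof. by move=> mx my; rewrite -scaleN1r; apply: mD => //; exact: mZ. Qed.
Let T_g x : g (T x). Proof. exact/m_sub_g/T_m. Qed.
Let fNl x z : f (- x) z = - f x z. Proof. by rewrite -scaleN1r fZl mulN1r. Qed.
Let fBl x y z : f (x - y) z = f x z - f y z. Proof. by rewrite fDl fNl. Qed.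
Let fBr x y z : f x (y - z) = f x y - f x z. Proof. by rewrite ![f x _]fC fBl. Qed.
Let f_sub_T x y : f (x - T x) y = f x (y - T y).
Proof. by rewrite fBl fBr T_adj. Qed.

Let br_skew x y v : g x -> g y -> g v -> f (br x v) y = - f (br y v) x.
Proof. by move=> xg yg vg; rewrite brC [br y v]brC fNl f_ad // fNl [in RHS]fC !opprK. Qed.

Let br_skewl x y v : g x -> g y -> g v -> f (br v x) y = - f (br v y) x.
Proof. by move=> xg yg vg; rewrite f_ad // fC. Qed.

Let fT_br x y z : m y -> f (br (T x) y) (T z) = f (br (T x) (T y)) z.
Proof. by move=> my; rewrite -T_adj T_br. Qed.

Lemma transport_op_m v x : m v -> m x -> m (transport_op v x).
Proof. by move=> mv mx; apply/mZ/mB; [apply: mD;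
  [exact: Pm_m|exact: m_br]|exact: m_br]. Qed.

Lemma christoffel_m u v : m u -> m v -> m (christoffel u v).
Proof. by move=> mu mv; apply/mZ/mD; [exact: Pm_m|apply: mD; exact: m_br]. Qed.

Lemma transport_op_q v x y : m v -> m x -> m y ->
  q (transport_op v x) y = beta0 / 2 *
    (f (br x v) y - f (br x v) (T y) + f (br (T v) x) y - f (br (T v) (T x)) y
     - f (br (T x) v) y + f (br (T x) v) (T y)).
Proof.
move=> mv mx my; rewrite qE; [|exact/m_sub_g/transport_op_m|exact: m_sub_g].
rewrite f_sub_T fZl fBl fDl f_Pm; last exact/mB/T_m.
by rewrite !fBr fT_br //; field.
Qed.

(** Exchanging x and y permutes the six terms of [transport_op_q] up to
sign, because ad v and ad (T v) are antisymmetric for f. *)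
Lemma transport_op_antisym v x y : m v -> m x -> m y ->
  q (transport_op v x) y = - q x (transport_op v y).
Proof.
move=> mv mx my; have mop := transport_op_m mv my.
have [vg xg yg] : [/\ g v, g x & g y] by split; exact: m_sub_g.
have [Tv Tx Ty] : [/\ g (T v), g (T x) & g (T y)] by split; exact: T_g.
have gP := m_sub_g mop.
rewrite [in RHS]qE // f_sub_T fC -qE // !transport_op_q //.
rewrite (br_skew (x := x) (y := y)) // (br_skew (x := x) (y := T y)) //.
rewrite (br_skew (x := T x) (y := y)) // (br_skew (x := T x) (y := T y)) //.
rewrite (br_skewl (x := x) (y := y)) // (br_skewl (x := T x) (y := y)) // fT_br //.
by field.
Qed.

Let qD x y z : g x -> g y -> g (x + y) -> g z -> q (x + y) z = q x z + q y z.
Proof. by move=> xg yg xyg zg; rewrite !qE // !f_sub_T fDl mulrDr. Qed.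

(** The two last Koszul terms add up to beta0 f E w with
E = [T y, z] + [T z, y]; since T E = 0, this is q E w. *)
Lemma koszul_solve y z dz D : m y -> m z -> m dz -> g D ->
  (forall w, m w -> 2 * q D w =
     2 * q dz w + q (br y z) w - q (br y w) z - q (br z w) y) ->
  forall w, m w -> q D w = q (dz + christoffel y z) w.
Proof.
move=> my mz mdz gD H w mw.
have [gy gz gw gdz] : [/\ g y, g z, g w & g dz] by split; exact: m_sub_g.
pose E := br (T y) z + br (T z) y.
have mE : m E by apply: mD; exact: m_br.
have TE : T E = 0 by rewrite TD !T_br // [br (T z) _]brC subrr.
have mwT : m (w - T w) by apply: mB.
have mch := christoffel_m my mz.
have qyw : q (br y w) z = beta0 * f (br (z - T z) y) w.
  rewrite qE //; last exact: g_br.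
  rewrite f_sub_T brC fNl br_skew ?opprK //; exact: gB.
have qzw : q (br z w) y = beta0 * f (br (y - T y) z) w.
  rewrite qE //; last exact: g_br.
  rewrite f_sub_T brC fNl br_skew ?opprK //; exact: gB.
have q1 : q (dz + christoffel y z) w = q dz w + 2^-1 * (q (br y z) w + beta0 * f E w).
  have mdzc := mD mdz mch.
  rewrite qD //; [|exact: m_sub_g..].
  rewrite (qE (m_sub_g mch)) // f_sub_T fZl fDl f_Pm // -!f_sub_T -/E TE subr0.
  rewrite (qE (g_br gy gz)) //.
  by field.
have := H w mw; rewrite q1 qyw qzw !brDl !brNl /E !fDl !fNl [br z y]brC fNl; lra.
Qed.

End MetricLieAlgebra.

(** * Matrix brackets and conjugation by one-parameter groups *)

Section Brackets.
Context (R : realType) (n : nat).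
Local Notation M := 'M[R]_n.+1.
Implicit Types x y z : M.
Local Notation "<| x , y |>" := (lie_bracket x y).

Lemma lieC x y : <|x, y|> = - <|y, x|>.
Proof. by rewrite /lie_bracket opprB. Qed.

Lemma liexx x : <|x, x|> = 0.
Proof. by rewrite /lie_bracket subrr. Qed.

Lemma lie_linearl y : linear (fun x : M => <|x, y|>).
Proof.
move=> c u v; rewrite /lie_bracket mulrDl mulrDr -scalerAl -scalerAr scalerBr.
by rewrite opprD addrACA.
Qed.

Lemma lie_linearr x : linear (fun y : M => <|x, y|>).
Proof. by move=> c u v; rewrite lieC lie_linearl opprD -scalerN -!lieC. Qed.

Lemma lieDl x y z : <|x + y, z|> = <|x, z|> + <|y, z|>.
Proof. by have := lie_linearl z 1 x y; rewrite !scale1r. Qed.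
Lemma lieDr x y z : <|x, y + z|> = <|x, y|> + <|x, z|>.
Proof. by have := lie_linearr x 1 y z; rewrite !scale1r. Qed.
Lemma lieNl x y : <|- x, y|> = - <|x, y|>.
Proof. by rewrite /lie_bracket mulNr mulrN opprD. Qed.
Lemma lieNr x y : <|x, - y|> = - <|x, y|>.
Proof. by rewrite lieC lieNl -lieC. Qed.
Lemma lieZl (c : R) x y : <|c *: x, y|> = c *: <|x, y|>.
Proof. by rewrite /lie_bracket -scalerAl -scalerAr scalerBr. Qed.
Lemma lieZr (c : R) x y : <|x, c *: y|> = c *: <|x, y|>.
Proof. by rewrite lieC lieZl -scalerN -lieC. Qed.

Definition Ad s t x : M := expm (t *: s) * x * expm (t *: - s).

Lemma AdD s t x y : Ad s t (x + y) = Ad s t x + Ad s t y.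
Proof. by rewrite /Ad mulrDr mulrDl. Qed.

Lemma AdZ s t c x : Ad s t (c *: x) = c *: Ad s t x.
Proof. by rewrite /Ad -scalerAr -scalerAl. Qed.

Lemma AdB s t x y : Ad s t (x - y) = Ad s t x - Ad s t y.
Proof. by rewrite /Ad mulrBr mulrBl. Qed.

Lemma AdK s t x : Ad s t (Ad (- s) t x) = x.
Proof. by rewrite /Ad opprK !mulrA expmVr mul1r -mulrA expmVr mulr1. Qed.

Lemma AdNK s t x : Ad (- s) t (Ad s t x) = x.
Proof. by have := AdK (- s) t x; rewrite opprK. Qed.

Lemma Ad0 s x : Ad s 0 x = x.
Proof. by rewrite /Ad !expm_scale0 mul1r mulr1. Qed.

Lemma Ad_self s t : Ad s t s = s.
Proof. by rewrite /Ad expm_comm // -mulrA expmVr mulr1. Qed.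

Lemma AdM s t x y : Ad s t (x * y) = Ad s t x * Ad s t y.
Proof.
rewrite /Ad; move: (expm (t *: s)) (expm (t *: - s)) (expmVl t s) => p p' pp.
by rewrite -!mulrA (mulrA p' p) pp mul1r.
Qed.

Lemma Ad_lie s t x y : Ad s t <|x, y|> = <|Ad s t x, Ad s t y|>.
Proof. by rewrite /lie_bracket -!AdM -AdB. Qed.

Lemma Ad_deriv s (v : R -> M) t dv : is_derive t (1 : R) v dv ->
  is_derive t (1 : R) (fun r => Ad s r (v r)) (Ad s t (dv + <|s, v t|>)).
Proof. exact: is_derive_Ad. Qed.

(** Both sides solve y' = [s, y] with the same initial value. *)
Lemma Ad_equivariant (U : {vspace M}) (f : M -> M) s x t : linear f ->
  {in U, forall y, f <|s, y|> = <|s, f y|>} ->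
  (forall r, Ad s r x \in U) -> f (Ad s t x) = Ad s t (f x).
Proof.
move=> lf fs xU.
have wd y (r : R) : is_derive r (1 : R) (fun r => Ad s r y) <|s, Ad s r y|>.
  have := Ad_deriv s (is_derive_cst y r (1 : R)).
  by rewrite add0r Ad_lie Ad_self.
have fd (r : R) : is_derive r (1 : R) (fun r => f (Ad s r x)) <|s, f (Ad s r x)|>.
  by rewrite -fs; [exact: (is_derive1_linear_mx lf (wd x r))|exact: xU].
have := expv_unique (lie_linearr s) fd t; rewrite /= Ad0 => ->.
by have := expv_unique (lie_linearr s) (wd (f x)) t; rewrite Ad0 => <-.
Qed.

End Brackets.

(** * Bilinear forms on a subspace of matrices *)

Section Forms.
Context (R : realType) (n : nat).
Local Notation M := 'M[R]_n.+1.
Implicit Types x y z : M.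
Local Notation "<| x , y |>" := (lie_bracket x y).

(** Precomposing with a linear projection onto U makes the form bilinear on
all matrices, without side conditions. *)
Definition ext_form (U : {vspace M}) (b : M -> M -> R) x y := b (projv U x) (projv U y).

Section Ext.
Variables (U : {vspace M}) (b : M -> M -> R).
Hypothesis hb : sym_bilinear_on U b.
Local Notation bU := (ext_form U b).

Lemma ext_formE x y : x \in U -> y \in U -> bU x y = b x y.
Proof. by move=> xU yU; rewrite /ext_form !projv_id. Qed.

Lemma ext_formC x y : bU x y = bU y x.
Proof. by have [bC _] := hb; rewrite /ext_form bC ?memv_proj. Qed.

Lemma ext_form_linearl y : linear (bU^~ y : M -> R).
Proof.
by move=> c u v; have [_ bl] := hb; rewrite /ext_form linearP bl ?memv_proj.
Qed.

Lemma ext_form_linearr x : linear (bU x : M -> R).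
Proof. by move=> c u v; rewrite ![bU x _]ext_formC ext_form_linearl. Qed.

Lemma ext_formDl x y z : bU (x + y) z = bU x z + bU y z.
Proof. by have := ext_form_linearl z 1 x y; rewrite !scale1r. Qed.
Lemma ext_formDr x y z : bU x (y + z) = bU x y + bU x z.
Proof. by rewrite ![bU x _]ext_formC ext_formDl. Qed.
Lemma ext_form0l z : bU 0 z = 0.
Proof. by apply: (addrI (bU 0 z)); rewrite -ext_formDl !addr0. Qed.
Lemma ext_formZl c x z : bU (c *: x) z = c * bU x z.
Proof. by have := ext_form_linearl z c x 0; rewrite !addr0 ext_form0l addr0. Qed.
Lemma ext_formZr c x z : bU x (c *: z) = c * bU x z.
Proof. by rewrite ext_formC ext_formZl ext_formC. Qed.
Lemma ext_formNl x z : bU (- x) z = - bU x z.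
Proof. by rewrite -scaleN1r ext_formZl mulN1r. Qed.
Lemma ext_formNr x z : bU x (- z) = - bU x z.
Proof. by rewrite -scaleN1r ext_formZr mulN1r. Qed.
Lemma ext_formBl x y z : bU (x - y) z = bU x z - bU y z.
Proof. by rewrite ext_formDl ext_formNl. Qed.
Lemma ext_formBr x y z : bU x (y - z) = bU x y - bU x z.
Proof. by rewrite ext_formDr ext_formNr. Qed.

Lemma ext_form_sumr (I : Type) (r : seq I) (c : I -> R) (e : I -> M) x :
  bU x (\sum_(i <- r) c i *: e i) = \sum_(i <- r) c i * bU x (e i).
Proof.
elim: r => [|i r IH]; first by rewrite !big_nil ext_formC ext_form0l.
by rewrite !big_cons ext_formDr ext_formZr IH.
Qed.

(** The coordinates of the projection are obtained by inverting the Gram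
matrix of a basis of W, whose kernel is zero by nondegeneracy. *)
Lemma orthproj_exists (W : {vspace M}) : (W <= U)%VS -> nondegenerate_on W b ->
  forall x, exists2 y, y \in W & {in W, forall z, bU (x - y) z = 0}.
Proof.
move=> WU ndW x; pose d := \dim W; pose e := vbasis W.
have eU i : e`_i \in U.
  have [id|id] := ltnP i (size e); last by rewrite nth_default ?mem0v.
  by apply: (subvP WU); rewrite vbasis_mem // mem_nth.
have eW (c : 'rV[R]_d) : \sum_(i < d) c 0 i *: e`_i \in W.
  by apply: memv_suml => i _; apply/memvZ/vbasis_mem/mem_nth; rewrite size_tuple.
have inW z : {in W, forall w, (forall i : 'I_d, bU z e`_i = 0) -> bU z w = 0}.
  move=> w wW ze; rewrite (coord_vbasis wW) ext_form_sumr big1 // => i _.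
  by rewrite ze mulr0.
pose Gram : 'M[R]_d := \matrix_(i, j) bU e`_i e`_j.
have GramE (c : 'rV[R]_d) j : (c *m Gram) 0 j = bU (\sum_(i < d) c 0 i *: e`_i) e`_j.
  rewrite mxE ext_formC ext_form_sumr; apply: eq_bigr => i _.
  by rewrite mxE ext_formC.
have Gu : Gram \in unitmx.
  rewrite -row_free_unit; apply: inj_row_free => c cG.
  have c0 : \sum_(i < d) c 0 i *: e`_i = 0.
    apply: ndW; first exact: eW.
    move=> w wW; rewrite -ext_formE; [|exact: (subvP WU)..].
    by apply: inW => // j; rewrite -GramE cG mxE.
  have /freeP := basis_free (vbasisP W); move=> /(_ (fun i => c 0 i) c0) ci.
  by apply/rowP => i; rewrite mxE.
(* coordinates c with c Gram = (b x e_j)_j *)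
pose c : 'rV[R]_d := (\row_j bU x e`_j) *m invmx Gram.
exists (\sum_(i < d) c 0 i *: e`_i); first exact: eW.
move=> z zW; apply: inW => // j.
by rewrite ext_formBl -GramE mulmxKV // mxE subrr.
Qed.

End Ext.

Lemma orthproj_unique (b : M -> M -> R) (W : set M) x y : W y ->
  (forall z, W z -> b (x - y) z = 0) ->
  (forall y', W y' -> (forall z, W z -> b (x - y') z = 0) -> y' = y) ->
  orthproj b W x = y.
Proof. by move=> Wy yP yU; apply: xget_unique => // y' [/yU]. Qed.

(** Derivative at 0 of the constant t |-> b (Ad x) (Ad y), for the
conjugation by exp (t z). *)
Lemma bi_invariant_ad (H : set M) (h : {vspace M}) (b : M -> M -> R) :
  is_subgroup_GL H -> is_lie_algebra_of H h -> bi_invariant H h b ->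
  {in h & &, forall z x y, ext_form h b <|z, x|> y = - ext_form h b x <|z, y|>}.
Proof.
move=> Hsub Hlie [hb bAd] z x y zh xh yh.
have Ad_h t v : v \in h -> expm (t *: z) * v * expm (t *: - z) \in h.
  by move=> vh; rewrite -expm_inv; apply: (Ad_mem Hsub Hlie) => //; exact: (Hlie z).1.
have dAd v : is_derive 0 (1 : R) (fun t => expm (t *: z) * v * expm (t *: - z)) <|z, v|>.
  have := is_derive_Ad z (is_derive_cst v 0 (1 : R)).
  by rewrite !expm_scale0 mul1r mulr1 add0r.
have d := is_derive1_bilinear_mx (ext_form_linearl hb) (ext_form_linearr hb) (dAd x)
  (dAd y).
have c : (fun t => ext_form h b (expm (t *: z) * x * expm (t *: - z))
           (expm (t *: z) * y * expm (t *: - z))) = cst (ext_form h b x y).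
  apply/funext => t /=; rewrite !ext_formE ?Ad_h //.
  by rewrite -expm_inv bAd //; exact: (Hlie z).1.
move: d; rewrite c !expm_scale0 !mul1r !mulr1 => -[_]; rewrite derive_cst => /esym/eqP.
by rewrite addr_eq0 => /eqP.
Qed.

End Forms.

(** * The deformed metric and the horizontal space *)

Section HorizontalGeometry.
Context (R : realType) (n : nat).
Local Notation M := 'M[R]_n.+1.
Implicit Types x y z : M.
Local Notation "<| x , y |>" := (lie_bracket x y).
Context (G A K : set M) (g a k : {vspace M}) (b : M -> M -> R) (B : M -> M) (beta0 : R).
Context (hG : connected_lie_subgroup G g)
  (hA : connected_lie_subgroup A a)
  (hAG : A `<=` G)
  (hb : bi_invariant G g b)
  (hb_g : nondegenerate_on g b)
  (hb_a : nondegenerate_on a b)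
  (hB : intertwining A a b B)
  (hB_inv : set_bij [set` a] [set` a] B)
  (hbeta0 : beta0 != 0)
  (hK : closed_lie_subgroup G g K k)
  (hb_k : nondegenerate_on k b)
  (hka : forall X Y, X \in k -> Y \in a -> lie_bracket X Y = 0)
  (hka_orth : forall X Y, X \in k -> Y \in a -> b X Y = 0).

Local Notation bg := (ext_form g b).
Local Notation q := (form_beta b a beta0 B).
Local Notation m := (orthocomp b g k).

Let Gsub : is_subgroup_GL G. Proof. by case: hG. Qed.
Let Glie : is_lie_algebra_of G g. Proof. by case: hG. Qed.
Let bsym : sym_bilinear_on g b. Proof. by case: hb. Qed.

Let bgC := ext_formC bsym.
Let bgDl := ext_formDl bsym.
Let bgDr := ext_formDr bsym.
Let bgZl := ext_formZl bsym.
Let bgZr := ext_formZr bsym.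
Let bgBl := ext_formBl bsym.
Let bgBr := ext_formBr bsym.
Let bgE x y : x \in g -> y \in g -> bg x y = b x y := @ext_formE R n g b x y.
Let bg_pl x y : bg (projv g x) y = bg x y.
Proof. by rewrite /ext_form projv_id ?memv_proj. Qed.

Lemma lie_g x y : x \in g -> y \in g -> <|x, y|> \in g.
Proof. by case: hG => _ _ + _; apply. Qed.

Lemma a_sub_g x : x \in a -> x \in g.
Proof.
move=> xa; apply/Glie => t; apply: hAG.
by have [_ Alie _ _] := hA; exact: (Alie x).1.
Qed.

Lemma k_sub_g x : x \in k -> x \in g.
Proof.
have [_ KG Klie _] := hK => xk; apply/Glie => t; apply: KG; exact: (Klie x).1.
Qed.

Let av : (a <= g)%VS. Proof. by apply/subvP => x; exact: a_sub_g. Qed.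
Let kv : (k <= g)%VS. Proof. by apply/subvP => x; exact: k_sub_g. Qed.

(** On g this is the b-orthogonal projection onto U; thanks to [projv] it is
linear on all matrices. *)
Definition projg (U : {vspace M}) x := orthproj b [set` U] (projv g x).

Section Proj.
Variables (U : {vspace M}) (Ug : (U <= g)%VS) (ndU : nondegenerate_on U b).

Lemma orthprojE x y : y \in U -> {in U, forall z, bg (x - y) z = 0} -> projg U x = y.
Proof.
move=> yU xy; have yg := subvP Ug _ yU.
apply: orthproj_unique => //= [z zU|y' y'U xy'].
  have zg := subvP Ug _ zU.
  rewrite -bgE ?memvB ?memv_proj //; apply: etrans (xy z zU).
  by rewrite !bgBl bg_pl.
have y'g := subvP Ug _ y'U.
apply/eqP; rewrite -subr_eq0; apply/eqP; apply: ndU; first exact: memvB.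
move=> z zU; have zg := subvP Ug _ zU.
rewrite -bgE ?memvB //; have := xy z zU; have := xy' z zU.
rewrite -bgE ?memvB ?memv_proj //.
by rewrite !bgBl bg_pl => e1 e2; lra.
Qed.

Lemma projgP x : projg U x \in U /\ {in U, forall z, bg (x - projg U x) z = 0}.
Proof. by have [y yU xy] := orthproj_exists bsym Ug ndU x; rewrite (orthprojE yU xy). Qed.

Lemma projg_mem x : projg U x \in U. Proof. by case: (projgP x). Qed.

Lemma projg_id x : x \in U -> projg U x = x.
Proof. by move=> xU; apply: orthprojE => // z _; rewrite subrr ext_form0l. Qed.

Lemma projg_linear : linear (projg U).
Proof.
move=> c u v; apply: orthprojE; first by rewrite memvD ?memvZ ?projg_mem.
move=> z zU; have [_ /(_ z zU)] := projgP u; have [_ /(_ z zU)] := projgP v.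
by rewrite !(bgBl, bgDl, bgZl) => e1 e2; rewrite -[RHS](mulr0 c) -{1}e2 -[RHS]addr0 -e1;
  ring.
Qed.

Lemma projg_symm x z : z \in U -> bg (projg U x) z = bg x z.
Proof. by move=> zU; have [_ /(_ z zU)] := projgP x; rewrite bgBl => e; lra. Qed.

Lemma projg_adj x y : bg (projg U x) y = bg x (projg U y).
Proof.
by rewrite -(projg_symm x) ?projg_mem // ![bg (projg U x) _]bgC projg_symm ?projg_mem.
Qed.

End Proj.

Local Notation Pa := (projg a).
Local Notation Pk := (projg k).
Definition projm x := projv g x - Pk x.
Local Notation Pm := projm.
(** The operator T of the theorem. *)
Definition twist x := Pa x + beta0^-1 *: B (Pa x).
Local Notation T := twist.

Let Pa_mem x : Pa x \in a := projg_mem av hb_a x.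
Let Pk_mem x : Pk x \in k := projg_mem kv hb_k x.
Let Pa_lin : linear Pa := projg_linear av hb_a.
Let Pk_lin : linear Pk := projg_linear kv hb_k.

Let B_mem x : x \in a -> B x \in a.
Proof. by have [[+ _] _ _] := hB; apply. Qed.

Lemma ad_inv x y z : x \in g -> y \in g -> z \in g -> bg <|z, x|> y = - bg x <|z, y|>.
Proof. by move=> xg yg zg; apply: (bi_invariant_ad Gsub Glie hb). Qed.

(** The forms b and (x, y) |-> b x (B y) are both ad-invariant on a, so that
b y (B [s, x]) and b y [s, B x] are both equal to - b [s, y] (B x). *)
Lemma B_ad s x : s \in a -> x \in a -> B <|s, x|> = <|s, B x|>.
Proof.
move=> sa xa; have [Asub Alie Abr _] := hA; have [_ Bsymm Binv] := hB.
have sxa : <|s, x|> \in a by apply: Abr.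
have sBa : <|s, B x|> \in a by apply: Abr => //; apply: B_mem.
apply/eqP; rewrite -subr_eq0; apply/eqP; apply: hb_a; first by rewrite memvB // B_mem.
move=> y ya.
have sya : <|s, y|> \in a by apply: Abr.
have := bi_invariant_ad Asub Alie Binv sa ya xa.
rewrite !ext_formE //.
rewrite -(bgE (a_sub_g ya) (a_sub_g (B_mem sxa))) -(bgE (a_sub_g sya) (a_sub_g (B_mem xa))).
rewrite ad_inv ?a_sub_g ?B_mem // => e.
rewrite -bgE; [|by rewrite memvB // a_sub_g // B_mem|exact: a_sub_g].
by rewrite bgC bgBr; lra.
Qed.

Lemma T_linear : linear T.
Proof.
have [[_ Blin] _ _] := hB => c u v; rewrite /T Pa_lin Blin // !scalerDr !scalerA.
by rewrite addrACA mulrC.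
Qed.

Lemma T_mem x : T x \in a.
Proof. by rewrite memvD ?memvZ ?B_mem. Qed.

Lemma T_adj x y : bg (T x) y = bg x (T y).
Proof.
rewrite /T bgDl bgDr bgZl bgZr projg_adj //; congr (_ + _ * _).
have [_ Bsymm _] := hB.
rewrite bgC -(projg_symm av hb_a y (B_mem (Pa_mem x))).
rewrite -(projg_symm av hb_a x (B_mem (Pa_mem y))) bgC.
by rewrite !bgE ?a_sub_g ?B_mem // Bsymm.
Qed.

Lemma Pa_ad s x : s \in a -> x \in g -> Pa <|s, x|> = <|s, Pa x|>.
Proof.
move=> sa xg; have [_ _ Abr _] := hA; apply: orthprojE => //; first exact: Abr.
move=> z za; have xPg : x - Pa x \in g by rewrite memvB // a_sub_g.
rewrite -lieNr -lieDr (ad_inv xPg (a_sub_g za) (a_sub_g sa)).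
have [_ xP] := projgP av hb_a x.
by rewrite xP ?oppr0 //; exact: Abr.
Qed.

Lemma T_ad s x : s \in a -> x \in g -> T <|s, x|> = <|s, T x|>.
Proof. by move=> sa xg; rewrite /T Pa_ad // B_ad // lieDr lieZr. Qed.

(** For z in k, b [s, x] z = - b x [s, z] and [s, z] = 0. *)
Lemma Pk_ad s x : s \in a -> x \in g -> Pk <|s, x|> = 0.
Proof.
move=> sa xg; apply: orthprojE => //; first exact: mem0v.
move=> z zk; rewrite subr0 (ad_inv xg (k_sub_g zk) (a_sub_g sa)) lieC hka // oppr0 (_ :
  bg x 0 = 0) ?oppr0 //.
by rewrite bgC; exact: (ext_form0l bsym).
Qed.

Lemma Pm_linear : linear Pm.
Proof. by move=> c u v; rewrite /Pm linearP Pk_lin scalerBr opprD addrACA. Qed.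

Lemma Pm_mem_g x : Pm x \in g.
Proof. by rewrite memvB ?memv_proj ?k_sub_g. Qed.

Lemma Pm_orth x z : z \in k -> bg (Pm x) z = 0.
Proof. by move=> zk; have [_ /(_ z zk)] := projgP kv hb_k x; rewrite !bgBl bg_pl. Qed.

(** Horizontality as a linear equation: it passes to limits and
derivatives. *)
Lemma orthocompP x : m x <-> Pm x = x.
Proof.
split=> [[xg xk]|<-].
  rewrite /Pm projv_id // (_ : Pk x = 0) ?subr0 //; apply: orthprojE => //.
    exact: mem0v.
  by move=> z zk; rewrite subr0 (bgE xg (k_sub_g zk)) xk.
split=> [|z zk]; first exact: Pm_mem_g.
by rewrite -(bgE (Pm_mem_g x) (k_sub_g zk)) Pm_orth.
Qed.

Lemma Pm_m x : m (Pm x).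
Proof.
apply/orthocompP; rewrite {1}/Pm projv_id ?Pm_mem_g // (_ : Pk _ = 0) ?subr0 //.
apply: orthprojE => //; first exact: mem0v.
by move=> z zk; rewrite subr0 Pm_orth.
Qed.

Lemma m_sub_g x : m x -> x \in g. Proof. by case. Qed.

Lemma m_orth x z : m x -> z \in k -> bg x z = 0.
Proof. by move=> [xg xk] zk; rewrite (bgE xg (k_sub_g zk)) xk. Qed.

Lemma a_m x : x \in a -> m x.
Proof.
move=> xa; split=> [|z zk]; first exact: a_sub_g.
have [xg zg] := (a_sub_g xa, k_sub_g zk).
by rewrite -bgE // bgC bgE // hka_orth.
Qed.

Lemma Pm_ad s x : s \in a -> x \in g -> Pm <|s, x|> = <|s, Pm x|>.
Proof.
move=> sa xg; rewrite {1}/Pm Pk_ad // subr0 projv_id; last by apply: lie_g => //;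
  exact: a_sub_g.
by rewrite /Pm lieDr lieNr [X in _ - X]lieC (hka (Pk_mem x) sa) oppr0 subr0 projv_id.
Qed.

Lemma m_lie_a s x : s \in a -> m x -> m <|s, x|>.
Proof. by move=> sa mx; apply/orthocompP;
  rewrite (Pm_ad sa (m_sub_g mx)) ((orthocompP x).1 mx). Qed.

Lemma m_linear c x y : m x -> m y -> m (c *: x + y).
Proof. by move=> /orthocompP mx /orthocompP my; apply/orthocompP;
  rewrite Pm_linear mx my. Qed.
Lemma m0 : m 0.
Proof. by apply: a_m; exact: mem0v. Qed.
Lemma mD x y : m x -> m y -> m (x + y).
Proof. by move=> mx my; have := m_linear 1 mx my; rewrite scale1r. Qed.
Lemma mZ c x : m x -> m (c *: x).
Proof. by move=> mx; have := m_linear c mx m0; rewrite addr0. Qed.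
Lemma mB x y : m x -> m y -> m (x - y).
Proof. by move=> mx my; rewrite -scaleN1r; apply: mD => //; exact: mZ. Qed.

Lemma PaE x : x \in g -> orthproj b [set` a] x = Pa x.
Proof. by move=> xg; rewrite /projg projv_id. Qed.
Lemma PkE x : x \in g -> orthproj b [set` k] x = Pk x.
Proof. by move=> xg; rewrite /projg projv_id. Qed.

Lemma bg_PmC x y : m y -> bg (Pm x) y = bg x y.
Proof. by move=> my; rewrite /Pm bgBl bg_pl [bg (Pk x) y]bgC (m_orth my
  (Pk_mem x)) subr0. Qed.

Lemma m_nondeg x : m x -> (forall y, m y -> bg x y = 0) -> x = 0.
Proof.
move=> mx xm; apply: hb_g; first exact: m_sub_g.
move=> y yg; rewrite -(bgE (m_sub_g mx) yg).
by rewrite bgC -bg_PmC // bgC xm //; exact: Pm_m.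
Qed.

Lemma PmE x : x \in g -> orthproj b m x = Pm x.
Proof.
move=> xg; apply: orthproj_unique; first exact: Pm_m.
  move=> z mz; rewrite -bgE; [|by apply: memvB => //; exact: Pm_mem_g|exact: m_sub_g].
  by rewrite bgBl bg_PmC // subrr.
move=> y my xy; apply/eqP; rewrite -subr_eq0; apply/eqP; apply: m_nondeg.
  by apply: mB => //; exact: Pm_m.
move=> z mz; have := xy z mz.
rewrite -bgE; [|by rewrite memvB // m_sub_g|exact: m_sub_g].
by rewrite (bgBl x) (bgBl y) bg_PmC // => e; lra.
Qed.

(** The metric is b twisted by 1 - T on one side, which turns statements on q
into statements on b. *)
Lemma qE x y : x \in g -> y \in g -> q x y = beta0 * bg (x - T x) y.
Proof.
move=> xg yg; rewrite /form_beta !PaE // (_ : B (Pa x) + _ = beta0 *: T x); last first.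
  by rewrite /T scalerDr scalerA divff // scale1r addrC.
have Txg : T x \in g by rewrite a_sub_g // T_mem.
rewrite -!bgE ?memvZ // ?(a_sub_g (Pa_mem y)) // bgBl bgZl mulrBr.
by rewrite -projg_adj // projg_id ?T_mem.
Qed.

(** A vector of the q-radical satisfies x = T x, hence lies in a, where
this says that B x = 0. *)
Lemma q_nondeg x : x \in g -> (forall y, y \in g -> q x y = 0) -> x = 0.
Proof.
move=> xg qx.
have bT y : y \in g -> bg (x - T x) y = 0.
  by move=> yg; have := qx y yg; rewrite qE // => /eqP;
    rewrite mulf_eq0 (negPf hbeta0) => /eqP.
have xT : x = T x.
  apply/eqP; rewrite -subr_eq0; apply/eqP; apply: hb_g.
    by rewrite memvB // a_sub_g // T_mem.
  by move=> y yg; rewrite -bgE ?bT // memvB // a_sub_g // T_mem.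
have xa : x \in a by rewrite xT T_mem.
have Bx0 : B x = 0.
  have /eqP : beta0^-1 *: B x = 0.
    by apply: (addrI x); rewrite addr0 {3}xT /T projg_id.
  by rewrite scaler_eq0 invr_eq0 (negPf hbeta0) => /eqP.
have [[_ Blin] _ _] := hB; have [_ Binj _] := hB_inv.
have B0 : B 0 = 0.
  by have := Blin (-1) 0 0 (mem0v _) (mem0v _); rewrite scaler0 addr0 scaleN1r addNr.
by apply: Binj; [exact: mem_set|apply: mem_set; exact: mem0v|rewrite Bx0 B0].
Qed.

Lemma q_nondeg_m x : m x -> (forall y, m y -> q x y = 0) -> x = 0.
Proof.
move=> mx qm; apply: q_nondeg; first exact: m_sub_g.
move=> y yg; rewrite -(qm (Pm y) (Pm_m y)) (qE (m_sub_g mx) yg) (qE (m_sub_g mx)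
  (Pm_mem_g y)); congr (_ * _).
rewrite [RHS]bgC bg_PmC; first by rewrite bgC.
by apply: mB => //; apply/a_m/T_mem.
Qed.

Lemma q_k x z : x \in g -> z \in k -> q x z = beta0 * bg x z.
Proof.
move=> xg zk; rewrite (qE xg (k_sub_g zk)) bgBl.
by rewrite [bg (T x) z](m_orth (a_m (T_mem x)) zk) subr0.
Qed.

Lemma HorE X : G X -> Hor g k q X = [set X * V | V in m].
Proof.
move=> GX; have Xu := G_unit Gsub GX; apply/seteqP; split=> [xi [xg xk]|_ [V mV <-]].
  exists (X^-1 * xi); last by rewrite mulVKr.
  split=> // z zk; have := xk z zk; rewrite /left_metric mulKr // q_k //.
  move/eqP; rewrite mulf_eq0 (negPf hbeta0) => /eqP.
  by rewrite bgE // k_sub_g.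
split; first by rewrite mulKr // m_sub_g.
by move=> z zk; rewrite /left_metric !mulKr // (q_k (m_sub_g mV) zk) (m_orth mV zk) mulr0.
Qed.

Lemma HorP X xi : G X -> Hor g k q X xi <-> m (X^-1 * xi).
Proof.
move=> GX; have Xu := G_unit Gsub GX; rewrite HorE //; split=> [[V mV <-]|mV].
  by rewrite mulKr.
by exists (X^-1 * xi); rewrite ?mulVKr.
Qed.

Lemma sub_twist_adj x y : bg (x - T x) y = bg x (y - T y).
Proof. by rewrite (bgBl x) (bgBr x) T_adj. Qed.

Lemma q_Pm x z : x \in g -> m z -> q (Pm x) z = q x z.
Proof.
move=> xg mz; have zg := m_sub_g mz; rewrite (qE (Pm_mem_g x) zg) (qE xg zg).
rewrite !sub_twist_adj bg_PmC //.
by apply: mB => //; exact/a_m/T_mem.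
Qed.

Lemma qB x y z : x \in g -> y \in g -> z \in g -> q (x - y) z = q x z - q y z.
Proof.
move=> xg yg zg; rewrite (qE (memvB xg yg) zg) (qE xg zg) (qE yg zg).
by rewrite !sub_twist_adj (bgBl x) mulrBr.
Qed.

(** Since q (k, m) = 0 and q is nondegenerate on m, the q-orthogonal
projection onto m is the b-orthogonal one. *)
Lemma Pm_unique x y : x \in g -> m y -> (forall z, m z -> q x z = q y z) -> Pm x = y.
Proof.
move=> xg my xy; apply/eqP; rewrite -subr_eq0; apply/eqP; apply: q_nondeg_m.
  by apply: mB => //; exact: Pm_m.
move=> z mz; rewrite (qB (Pm_mem_g x) (m_sub_g my) (m_sub_g mz)) (q_Pm xg mz).
by rewrite xy // subrr.
Qed.

Lemma hprojE X xi : G X -> X^-1 * xi \in g -> hproj g k q X xi = X * Pm (X^-1 * xi).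
Proof.
move=> GX; have Xu := G_unit Gsub GX; rewrite /hproj /left_metric.
move eV : (X^-1 * xi) => V Vg.
have -> : xi = X * V by rewrite -eV mulVKr.
apply: orthproj_unique => [|z /(HorP _ GX) mz|y /(HorP _ GX) my yP].
- by apply/(HorP _ GX); rewrite mulKr //; exact: Pm_m.
- rewrite mulrBr !mulKr // (qB Vg (Pm_mem_g V) (m_sub_g mz)).
  by rewrite q_Pm // subrr.
rewrite (Pm_unique Vg my) ?mulVKr // => z mz.
have Xz : Hor g k q X (X * z) by apply/(HorP _ GX); rewrite mulKr.
have := yP _ Xz; rewrite mulrBr !mulKr // (qB Vg (m_sub_g my) (m_sub_g mz)).
by move/eqP; rewrite subr_eq0 => /eqP.
Qed.

Lemma T_lie_a x y : m y -> T <|T x, y|> = <|T x, T y|>.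
Proof. by move=> my; apply: T_ad; [exact: T_mem|exact: m_sub_g]. Qed.

Let Tm x : m (T x). Proof. exact/a_m/T_mem. Qed.
Let m_T_lie x y : m y -> m <|T x, y|>. Proof. exact/m_lie_a/T_mem. Qed.
Let TD x y : T (x + y) = T x + T y.
Proof. by have := T_linear 1 x y; rewrite !scale1r. Qed.
Let gB x y : x \in g -> y \in g -> x - y \in g. Proof. exact: memvB. Qed.

Definition transport_gen := transport_op (@lie_bracket R n) T Pm.
Definition h_christoffel := christoffel (@lie_bracket R n) T Pm.

Lemma transport_gen_m V x : m V -> m x -> m (transport_gen V x).
Proof. exact: (transport_op_m mD mZ m_T_lie Pm_m). Qed.

Lemma h_christoffel_m u v : m u -> m v -> m (h_christoffel u v).
Proof. exact: (christoffel_m mD mZ m_T_lie Pm_m). Qed.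

Lemma transport_gen_antisym V x y : m V -> m x -> m y ->
  q (transport_gen V x) y = - q x (transport_gen V y).
Proof.
exact: (transport_op_antisym (g := fun x => x \in g) (@lieC R n) bgC bgDl bgZl ad_inv
  m_sub_g mD mZ T_adj Tm T_lie_a m_T_lie Pm_m bg_PmC qE).
Qed.

Lemma koszul_horizontal y z dz D : m y -> m z -> m dz -> D \in g ->
  (forall w, m w -> 2 * q D w =
     2 * q dz w + q <|y, z|> w - q <|y, w|> z - q <|z, w|> y) ->
  Pm D = dz + h_christoffel y z.
Proof.
move=> my mz mdz Dg H; apply: (Pm_unique Dg (mD mdz (h_christoffel_m my mz))).
exact: (koszul_solve (g := fun x => x \in g) (@lieC R n) (@lieDl R n) (@lieNl R n)
  bgC bgDl bgZl gB lie_g ad_inv m_sub_g mD mZ TD T_adj Tm T_lie_a m_T_lie Pm_m bg_PmC qE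
  my mz mdz Dg H).
Qed.

Let qC x y : x \in g -> y \in g -> q x y = q y x.
Proof. by move=> xg yg; rewrite (qE xg yg) (qE yg xg) sub_twist_adj bgC. Qed.

Let qD x y z : x \in g -> y \in g -> z \in g -> q (x + y) z = q x z + q y z.
Proof.
move=> xg yg zg; rewrite (qE (memvD xg yg) zg) (qE xg zg) (qE yg zg).
by rewrite !sub_twist_adj (bgDl x) mulrDr.
Qed.

(** * The Levi-Civita connections of G and of G/K *)

Let Gu X : G X -> X \is a GRing.unit := @G_unit R n G Gsub X.

Lemma ltriv_curve Z X xi : vector_field G g Z -> G X -> X^-1 * xi \in g ->
  is_derive 0 (1 : R) (fun s => ltriv Z (X * expm (s *: (X^-1 * xi)))) (dltriv Z X xi).
Proof.
move=> [Zs _] GX xg; have [csm cd] := smooth_exp_curve Gsub Glie GX xg.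
have := is_derive_ltriv Gsub Glie 0 Zs csm; rewrite derive1E.
have [_ ->] := cd 0.
by rewrite expm_scale0 mulr1 mulVKr //; exact: Gu.
Qed.

Lemma exp_curve_G X xi s : G X -> X^-1 * xi \in g -> G (X * expm (s *: (X^-1 * xi))).
Proof.
by move=> GX xg; have [[_ /(_ s)[]]] := smooth_exp_curve Gsub Glie GX xg.
Qed.

Lemma dltriv_g Z X xi : vector_field G g Z -> G X -> X^-1 * xi \in g ->
  dltriv Z X xi \in g.
Proof.
move=> ZV GX xg; apply: derive_memv (ltriv_curve ZV GX xg) => s.
by apply: ZV.2; exact: exp_curve_G.
Qed.

Lemma derive_m (c : R -> M) t dc : (forall s, m (c s)) -> is_derive t (1 : R) c dc -> m dc.
Proof.
move=> mc d; apply/orthocompP; have := is_derive1_linear_mx Pm_linear d.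
rewrite (_ : (fun s => _) = c); first by case=> _ <-; case: d.
by apply/funext => s; apply/orthocompP.
Qed.

Lemma dltriv_m Z X xi : horizontal_field G g k q Z -> G X -> X^-1 * xi \in g ->
  m (dltriv Z X xi).
Proof.
move=> [ZV ZH] GX xg; apply: derive_m (ltriv_curve ZV GX xg) => s.
have Gc := exp_curve_G s GX xg.
by have /(HorP _ Gc) := ZH _ Gc.
Qed.

Lemma dirD_metric Z W X xi : vector_field G g Z -> vector_field G g W ->
  G X -> X^-1 * xi \in g ->
  dirD (fun X => left_metric q X (Z X) (W X)) X xi =
  q (dltriv Z X xi) (ltriv W X) + q (ltriv Z X) (dltriv W X xi).
Proof.
move=> ZV WV GX xg.
pose Q x y : R := beta0 * bg (x - T x) y.
have Ql1 y : linear (Q^~ y).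
  move=> c u v; rewrite /Q !sub_twist_adj bgDl bgZl mulrDr; congr (_ + _).
  by rewrite mulrCA.
have Ql2 y : linear (Q y).
  by move=> c u v; rewrite /Q bgDr bgZr mulrDr; congr (_ + _); rewrite mulrCA.
have d := is_derive1_bilinear_mx Ql1 Ql2 (ltriv_curve ZV GX xg) (ltriv_curve WV GX xg).
rewrite /dirD derive1E.
rewrite (_ : (fun t => _) = (fun s => Q (ltriv Z (X * expm (s *: (X^-1 * xi))))
                                 (ltriv W (X * expm (s *: (X^-1 * xi)))))); last first.
  apply/funext => s; have Gc := exp_curve_G s GX xg.
  by rewrite /left_metric (qE (ZV.2 _ Gc) (WV.2 _ Gc)).
have [_ ->] := d; rewrite expm_scale0 mulr1.
by rewrite (qE (dltriv_g ZV GX xg) (WV.2 X GX)) (qE (ZV.2 X GX) (dltriv_g WV GX xg)).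
Qed.

(** The bracket term comes from the product rule: left-invariant fields
have constant trivialisations but do not commute. *)
Lemma field_bracketE Y Z X : G X -> X^-1 * field_bracket Y Z X =
  dltriv Z X (Y X) - dltriv Y X (Z X) + <|ltriv Y X, ltriv Z X|>.
Proof.
move=> GX; rewrite /field_bracket mulrBr /dltriv /lie_bracket -/(ltriv Y X) -/(ltriv Z X).
move: (X^-1 * dirD Z X _) (X^-1 * dirD Y X _) (ltriv Y X * _) (ltriv Z X * _) => u v p r.
by apply/matrixP => i j; rewrite !mxE; ring.
Qed.

(** The Koszul argument, with n and d standing for the terms in the
connection and in the derivatives of the fields: the sum of the first two
metric identities minus the third, simplified by the torsion identities. *)
Lemma koszul_arith (nyzw nywz nzyw nzwy nwyz nwzy dyzw dywz dzyw dzwy dwyz dwzy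
    cyzw cywz czwy : R) :
  dyzw + dywz = nyzw + nywz -> dzwy + dzyw = nzwy + nzyw -> dwyz + dwzy = nwyz + nwzy ->
  nyzw - nzyw = dyzw - dzyw + cyzw -> nywz - nwyz = dywz - dwyz + cywz ->
  nzwy - nwzy = dzwy - dwzy + czwy ->
  2 * nyzw = 2 * dyzw + cyzw - cywz - czwy.
Proof. by lra. Qed.

Section Koszul.
Context (Cf : set (M -> R)) (F : set (M -> M)) (fbr nab : (M -> M) -> (M -> M) -> M -> M).
Hypothesis LC : levi_civita G q Cf F fbr nab.
Hypothesis F_field : forall Y, F Y -> vector_field G g Y.
Hypothesis fbrE : forall Y Z W X, F Y -> F Z -> F W -> G X ->
  left_metric q X (fbr Y Z X) (W X) = left_metric q X (field_bracket Y Z X) (W X).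

(** This serves both for G and for G/K. In the second case [fbr] is the
horizontal part of the bracket, which has the same pairing with horizontal
fields as the bracket. *)
Lemma koszul_field Y Z W X : F Y -> F Z -> F W -> G X ->
  2 * q (X^-1 * nab Y Z X) (ltriv W X) =
    2 * q (dltriv Z X (Y X)) (ltriv W X) + q <|ltriv Y X, ltriv Z X|> (ltriv W X)
    - q <|ltriv Y X, ltriv W X|> (ltriv Z X) - q <|ltriv Z X, ltriv W X|> (ltriv Y X).
Proof.
move=> FY FZ FW GX; have [nabF _ _ tors metr] := LC.
have lg U : F U -> ltriv U X \in g by move=> FU; have [_] := F_field FU; apply.
have dg U U' : F U -> F U' -> dltriv U X (U' X) \in g.
  by move=> FU FU'; apply: dltriv_g (F_field FU) GX (lg _ FU').
have ng U U' : F U -> F U' -> X^-1 * nab U U' X \in g.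
  by move=> FU FU'; exact: (lg _ (nabF _ _ FU FU')).
have metric U V W' : F U -> F V -> F W' ->
    q (dltriv V X (U X)) (ltriv W' X) + q (dltriv W' X (U X)) (ltriv V X) =
    q (X^-1 * nab U V X) (ltriv W' X) + q (X^-1 * nab U W' X) (ltriv V X).
  move=> FU FV FW'; have := metr _ _ _ FU FV FW' X GX.
  rewrite (dirD_metric (F_field FV) (F_field FW') GX (lg _ FU)) /left_metric.
  rewrite -/(ltriv W' X) -/(ltriv V X) (qC (lg _ FV) (dg _ _ FW' FU)).
  by rewrite (qC (lg _ FV) (ng _ _ FU FW')).
have torsion U V W' : F U -> F V -> F W' ->
    q (X^-1 * nab U V X) (ltriv W' X) - q (X^-1 * nab V U X) (ltriv W' X) =
    q (dltriv V X (U X)) (ltriv W' X) - q (dltriv U X (V X)) (ltriv W' X)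
    + q <|ltriv U X, ltriv V X|> (ltriv W' X).
  move=> FU FV FW'; have wg := lg _ FW'.
  have := fbrE FU FV FW' GX; rewrite -(tors _ _ FU FV X GX) /left_metric mulrBr.
  rewrite field_bracketE // -/(ltriv W' X).
  rewrite (qB (ng _ _ FU FV) (ng _ _ FV FU) wg) => ->.
  have d1 := dg _ _ FV FU; have d2 := dg _ _ FU FV.
  by rewrite (qD (memvB d1 d2) (lie_g (lg _ FU) (lg _ FV)) wg) (qB d1 d2 wg).
exact: (koszul_arith (metric _ _ _ FY FZ FW) (metric _ _ _ FZ FW FY)
  (metric _ _ _ FW FY FZ) (torsion _ _ _ FY FZ FW) (torsion _ _ _ FY FW FZ)
  (torsion _ _ _ FZ FW FY)).
Qed.

Lemma nab_horizontal Y Z X : F Y -> F Z -> G X ->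
  horizontal_field G g k q Y -> horizontal_field G g k q Z ->
  (forall w, m w -> exists2 W, F W & ltriv W X = w) ->
  Pm (X^-1 * nab Y Z X) = dltriv Z X (Y X) + h_christoffel (ltriv Y X) (ltriv Z X).
Proof.
move=> FY FZ GX [YV YH] ZHf Fw; have [ZV ZH] := ZHf.
have my : m (ltriv Y X) by exact: (HorP _ GX).1 (YH _ GX).
have mz : m (ltriv Z X) by exact: (HorP _ GX).1 (ZH _ GX).
apply: koszul_horizontal => //; first exact: (dltriv_m ZHf GX (m_sub_g my)).
  by have [nabF _ _ _ _] := LC; apply: (F_field (nabF _ _ FY FZ)).2.
by move=> w /Fw [W FW <-]; exact: koszul_field.
Qed.

End Koszul.

Lemma left_invariant_field w : w \in g -> vector_field G g (fun X => X * w).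
Proof.
move=> wg; split=> [|X GX]; last by rewrite mulKr ?Gu.
apply: (Cinf_smooth_on g Gsub) => j.
by apply: (Ck_linear (f := id) (@unitmx_open R n) (linear_mulr w)); exact: Cinf_id.
Qed.

Lemma hproj_bracket Y Z W X : vector_field G g Y -> vector_field G g Z ->
  horizontal_field G g k q W -> G X ->
  left_metric q X (hproj g k q X (field_bracket Y Z X)) (W X) =
  left_metric q X (field_bracket Y Z X) (W X).
Proof.
move=> YV ZV [_ WH] GX.
have mw := (HorP _ GX).1 (WH _ GX).
have brg : X^-1 * field_bracket Y Z X \in g.
  rewrite field_bracketE //; apply: memvD; last exact: lie_g (YV.2 X GX) (ZV.2 X GX).
  by apply: memvB; [exact: dltriv_g ZV GX (YV.2 X GX)|exact: dltriv_g YV GX (ZV.2 X GX)].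
by rewrite (hprojE GX brg) /left_metric mulKr ?q_Pm ?Gu.
Qed.

Lemma connectionG nabG Y Z X : levi_civita_G G g q nabG ->
  horizontal_field G g k q Y -> horizontal_field G g k q Z -> G X ->
  horizontal_connection g k q nabG Y Z X =
  X * (dltriv Z X (Y X) + h_christoffel (ltriv Y X) (ltriv Z X)).
Proof.
move=> LC YH ZH GX.
have [nabF _ _ _ _] := LC.
rewrite /horizontal_connection hprojE //; last exact: (nabF _ _ YH.1 ZH.1).2.
rewrite (nab_horizontal LC _ _ YH.1 ZH.1 GX YH ZH) // => w mw.
exists (fun X => X * w); first exact/left_invariant_field/m_sub_g.
by rewrite /ltriv mulKr ?Gu.
Qed.

(** The right-invariant field X |-> C X generates the left action of
exp (t C), which induces a Killing field of G/K; this is its horizontal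
lift. *)
Definition lifted_killing C X : M := X * Pm (X^-1 * C * X).

Let Ksub : is_subgroup_GL K. Proof. by case: hK. Qed.
Let KG X : K X -> G X. Proof. by case: hK => _ + _ _; apply. Qed.
Let Klie : is_lie_algebra_of K k. Proof. by case: hK. Qed.

(** Conjugation by an element of K preserves b and k, hence the orthogonal
decomposition of g. *)
Lemma Pm_AdK h x : K h -> x \in g -> Pm (h^-1 * x * h) = h^-1 * Pm x * h.
Proof.
move=> Kh xg; have [_ _ Ki] := Ksub; have [hu Kh'] := Ki _ Kh.
have [_ _ Gi] := Gsub; have [_ Gh'] := Gi _ (KG Kh).
have Adg y : y \in g -> h^-1 * y * h \in g.
  by move=> yg; have := Ad_mem Gsub Glie Gh' yg; rewrite invrK.
have Adk y : y \in k -> h^-1 * y * h \in k.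
  by move=> yk; have := Ad_mem Ksub Klie Kh' yk; rewrite invrK.
have Adk' y : y \in k -> h * y * h^-1 \in k.
  by move=> yk; exact: (Ad_mem Ksub Klie Kh yk).
have -> : h^-1 * Pm x * h = h^-1 * x * h - h^-1 * Pk x * h.
  by rewrite /projm projv_id // mulrBr mulrBl.
rewrite /projm projv_id ?Adg //; congr (_ - _).
apply: (orthprojE kv hb_k); first exact: Adk.
move=> z zk; rewrite -mulrBl -mulrBr.
have xPg : x - Pk x \in g by rewrite memvB // k_sub_g.
have [_ bAd] := hb.
have zg := k_sub_g (Adk' z zk).
have e : bg (x - Pk x) (h * z * h^-1) = 0.
  by have [_ xP] := projgP kv hb_k x; apply: xP; exact: Adk'.
have := bAd _ Gh' _ _ xPg zg; rewrite invrK.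
have -> : h^-1 * (h * z * h^-1) * h = z by rewrite !mulrA mulVr // mul1r mulrVK.
by rewrite -(bgE xPg zg) e -(bgE (Adg _ xPg) (k_sub_g zk)).
Qed.

Lemma killing_quotient C : C \in g -> quotient_field G g K k q (lifted_killing C).
Proof.
move=> Cg.
have XCX X : G X -> X^-1 * C * X \in g.
  move=> GX; have [_ _ Gi] := Gsub; have [_ GX'] := Gi _ GX.
  by have := Ad_mem Gsub Glie GX' Cg; rewrite invrK.
split; last first.
  move=> X h GX Kh; have [_ _ Ki] := Ksub; have [hu _] := Ki _ Kh.
  rewrite /lifted_killing (invrM (Gu GX) hu).
  rewrite (_ : h^-1 / X * C * (X * h) = h^-1 * (X^-1 * C * X) * h); last by rewrite !mulrA.
  by rewrite (Pm_AdK Kh (XCX X GX)) !mulrA mulrK.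
have Hk X : G X -> m (X^-1 * lifted_killing C X).
  by move=> GX; rewrite mulKr ?Gu //; exact: Pm_m.
split; last by move=> X GX; apply/(HorP _ GX)/Hk.
split; last by move=> X GX; exact/m_sub_g/Hk.
apply: (Cinf_smooth_on g Gsub) => j.
have oU := @unitmx_open R n.
have idC : Ck j [set X : M | X \is a GRing.unit] (fun X : M => X) by exact: Cinf_id.
apply: (Ck_mul oU idC); apply: (Ck_linear oU Pm_linear); apply: (Ck_mul oU _ idC).
by apply: (Ck_linear oU (linear_mulr C)); apply: (Ck_inv oU).
Qed.

(** Ad X maps g onto g, so these fields take every horizontal value. *)
Lemma killing_at X w : G X -> m w ->
  X * w * X^-1 \in g /\ lifted_killing (X * w * X^-1) X = X * w.
Proof.
move=> GX mw; split; first exact: (Ad_mem Gsub Glie GX (m_sub_g mw)).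
by rewrite /lifted_killing !mulrA mulVr ?Gu // mul1r mulrVK ?Gu // ((orthocompP w).1 mw).
Qed.

Lemma connectionQ nabQ Y Z X : levi_civita_quotient G g K k q nabQ ->
  quotient_field G g K k q Y -> quotient_field G g K k q Z -> G X ->
  nabQ Y Z X = X * (dltriv Z X (Y X) + h_christoffel (ltriv Y X) (ltriv Z X)).
Proof.
move=> LC YQ ZQ GX; have [nabF _ _ _ _] := LC.
rewrite -(nab_horizontal LC _ _ YQ ZQ GX YQ.1 ZQ.1).
- have /(HorP _ GX)/orthocompP -> := (nabF _ _ YQ ZQ).1.2 X GX.
  by rewrite mulVKr ?Gu.
- by move=> U [[]].
- by move=> U V W X' UQ VQ WQ GX'; apply: hproj_bracket => //;
  [exact: UQ.1.1|exact: VQ.1.1|exact: WQ.1].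
move=> w mw; have [Cg CE] := killing_at GX mw.
exists (lifted_killing (X * w * X^-1)); first exact: killing_quotient.
by rewrite /ltriv CE mulKr ?Gu.
Qed.

Lemma Cinf_h_christoffel (u v : R -> M) : Cinf setT u -> Cinf setT v ->
  Cinf setT (fun t => h_christoffel (u t) (v t)).
Proof.
move=> uC vC j; have oT := @openT R.
have lieC' (x y : R -> M) : Ck j setT x -> Ck j setT y ->
    Ck j setT (fun t => <|x t, y t|>).
  move=> xC yC; apply: (Ck_add oT); first exact: Ck_mul.
  by apply: (Ck_linear (l := -%R) oT); [move=> c w z; rewrite opprD scalerN|exact: Ck_mul].
have lh : linear (fun x : M => (2^-1 : R) *: x).
  by move=> c w z; rewrite scalerDr !scalerA mulrC.
apply: (Ck_linear oT lh); apply: (Ck_add oT).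
  by apply: (Ck_linear oT Pm_linear); apply: lieC'.
by apply: (Ck_add oT); apply: lieC' => //; exact: (Ck_linear oT T_linear).
Qed.

Lemma h_christoffel_linear u : linear (h_christoffel u).
Proof.
move=> c v w; have lieP x y z : <|x, c *: y + z|> = c *: <|x, y|> + <|x, z|>.
  by rewrite lieDr lieZr.
rewrite /h_christoffel /christoffel lieP Pm_linear lieP T_linear (lieDl (c *: T v)
  (T w)) (lieZl c (T v)).
move: (Pm <|u, v|>) (Pm <|u, w|>) <|T u, v|> <|T u, w|> <|T v, u|> <|T w, u|>.
move=> x1 x2 x3 x4 x5 x6.
by apply/matrixP => i j; rewrite !mxE; ring.
Qed.

Lemma killing_linear X : linear (lifted_killing^~ X).
Proof.
move=> c u v; have e : X^-1 * (c *: u + v) * X = c *: (X^-1 * u * X) + X^-1 * v * X.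
  by rewrite mulrDr mulrDl -scalerAr -scalerAl.
by rewrite /lifted_killing e Pm_linear mulrDr -scalerAr.
Qed.

(** * Covariant derivative along a horizontal curve *)

Section Along.
Context (gamma : R -> M).
Hypothesis hgam : horizontal_curve G g k q gamma.

Definition along_velocity t := (gamma t)^-1 * derive1 gamma t.
Definition along_ltriv (zeta : R -> M) t := (gamma t)^-1 * zeta t.

(** The candidate for the covariant derivative along gamma. *)
Definition cov_deriv zeta t :=
  gamma t * (derive1 (along_ltriv zeta) t +
    h_christoffel (along_velocity t) (along_ltriv zeta t)).

Local Notation HF := (horizontal_along g k q gamma).

Let gG t : G (gamma t). Proof. by have [[_ /(_ t)[]]] := hgam. Qed.
Let gC : Cinf setT gamma. Proof. by have [[]] := hgam. Qed.
Let gsm : smooth_curve G g gamma. Proof. by case: hgam. Qed.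
Let gU t : gamma t \is a GRing.unit := Gu (gG t).
Let gVC : Cinf setT (fun t => (gamma t)^-1).
Proof. by move=> j; exact: (Ck_inv openT (fun t _ => gU t) (gC j)). Qed.

Lemma along_velocity_m t : m (along_velocity t).
Proof. by have [_ /(_ t)/(HorP _ (gG t))] := hgam. Qed.

Lemma Cinf_along_ltriv zeta : Cinf setT zeta -> Cinf setT (along_ltriv zeta).
Proof. by move=> zC j; exact: (Ck_mul openT (gVC j) (zC j)). Qed.

Lemma along_ltriv_derive zeta t : Cinf setT zeta ->
  is_derive t (1 : R) (along_ltriv zeta) (derive1 (along_ltriv zeta) t).
Proof. by move=> zC; apply: Cinf_is_derive1; exact: Cinf_along_ltriv. Qed.

Lemma horizontal_alongP zeta : HF zeta <-> Cinf setT zeta /\ forall t, m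
  (along_ltriv zeta t).
Proof.
split=> -[zC zH]; split=> // t; first exact: (HorP _ (gG t)).1 (zH t).
exact: (HorP _ (gG t)).2 (zH t).
Qed.

Lemma horizontal_alongD zeta zeta' : HF zeta -> HF zeta' -> HF (fun s => zeta s + zeta' s).
Proof.
move=> /horizontal_alongP[zC zm] /horizontal_alongP[zC' zm']; apply/horizontal_alongP;
  split=> [j|t].
  exact: (Ck_add openT (zC j) (zC' j)).
by rewrite /along_ltriv mulrDr; apply: mD; [exact: zm|exact: zm'].
Qed.

Lemma horizontal_alongZ (f : R -> R) zeta : Cinf setT f -> HF zeta -> HF (fun s =>
  f s *: zeta s).
Proof.
move=> fC /horizontal_alongP[zC zm]; apply/horizontal_alongP; split=> [j|t];
  first exact: (Ck_scale openT (fC j) (zC j)).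
by rewrite /along_ltriv -scalerAr; apply: mZ; exact: zm.
Qed.

Lemma cov_deriv_horizontal zeta : HF zeta -> HF (cov_deriv zeta).
Proof.
move=> /horizontal_alongP[zC zm]; apply/horizontal_alongP; split=> [j|t].
  apply: (Ck_mul openT (gC j)); apply: (Ck_add openT).
    exact: (Cinf_derive1 (Cinf_along_ltriv zC)).
  exact: (Cinf_h_christoffel (Cinf_along_ltriv (Cinf_derive1 gC)) (Cinf_along_ltriv zC)).
rewrite /along_ltriv /cov_deriv mulKr //; apply: mD.
  exact: derive_m zm (along_ltriv_derive t zC).
by apply: h_christoffel_m; [exact: along_velocity_m|exact: zm].
Qed.

Lemma cov_derivP zeta t dv : is_derive t (1 : R) (along_ltriv zeta) dv ->
  cov_deriv zeta t = gamma t * (dv + h_christoffel (along_velocity t) (along_ltriv zeta t)).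
Proof. by move=> [_ e]; rewrite /cov_deriv derive1E e. Qed.

Lemma cov_derivD zeta zeta' t : HF zeta -> HF zeta' ->
  cov_deriv (fun s => zeta s + zeta' s) t = cov_deriv zeta t + cov_deriv zeta' t.
Proof.
move=> [zC _] [zC' _].
have d := is_deriveD (along_ltriv_derive t zC) (along_ltriv_derive t zC').
rewrite (_ : along_ltriv zeta + along_ltriv zeta' = along_ltriv (fun s =>
  zeta s + zeta' s)) in d; last first.
  by apply/funext => s; rewrite /along_ltriv mulrDr.
rewrite (cov_derivP d) /cov_deriv -mulrDr; congr (_ * _).
have := h_christoffel_linear (along_velocity t) 1 (along_ltriv zeta t)
  (along_ltriv zeta' t); rewrite !scale1r.
by rewrite /along_ltriv mulrDr => ->; rewrite addrACA.
Qed.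

Lemma cov_derivZ (f : R -> R) zeta t : Cinf setT f -> HF zeta ->
  cov_deriv (fun s => f s *: zeta s) t =
  derive1 f t *: zeta t + f t *: cov_deriv zeta t.
Proof.
move=> fC [zC _].
have fd := Cinf_is_derive1 t fC; have zd := along_ltriv_derive t zC.
have d : is_derive t (1 : R) (along_ltriv (fun s => f s *: zeta s))
    (derive1 f t *: along_ltriv zeta t + f t *: derive1 (along_ltriv zeta) t).
  rewrite (_ : along_ltriv _ = fun s => f s *: along_ltriv zeta s); last first.
    by apply/funext => s; rewrite /along_ltriv -scalerAr.
  exact: is_derive1_scale.
rewrite (cov_derivP d) /cov_deriv.
have -> : along_ltriv (fun s => f s *: zeta s) t =
  f t *: along_ltriv zeta t by rewrite /along_ltriv -scalerAr.
have := h_christoffel_linear (along_velocity t) (f t) (along_ltriv zeta t) 0.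
have -> : h_christoffel (along_velocity t) 0 =
  0 by have := h_christoffel_linear (along_velocity t) (-1) 0 0;
  rewrite scaler0 addr0 scaleN1r addNr.
rewrite !addr0 => ->.
rewrite -addrA -scalerDr mulrDr -!scalerAr /along_ltriv; congr (_ *: _ + _).
by rewrite mulVKr.
Qed.

Lemma cov_deriv_field nabQ Y Z t : levi_civita_quotient G g K k q nabQ ->
  quotient_field G g K k q Y -> quotient_field G g K k q Z ->
  Y (gamma t) = derive1 gamma t ->
  cov_deriv (Z \o gamma) t = nabQ Y Z (gamma t).
Proof.
move=> LC YQ ZQ Yt; rewrite (connectionQ LC YQ ZQ (gG t)).
rewrite (cov_derivP (is_derive_ltriv Gsub Glie t ZQ.1.1.1 gsm)).
by rewrite -Yt /along_velocity -Yt.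
Qed.

Lemma covariant_cov_deriv nabQ : levi_civita_quotient G g K k q nabQ ->
  covariant_along G g K k q nabQ gamma cov_deriv.
Proof.
move=> LC; split.
- exact: cov_deriv_horizontal.
- by move=> *; exact: cov_derivD.
- by move=> *; exact: cov_derivZ.
- by move=> *; exact: cov_deriv_field.
Qed.

Lemma killing_horizontal_along C : C \in g -> HF (lifted_killing C \o gamma).
Proof.
move=> Cg; split=> [j|t]; last exact: (killing_quotient Cg).1.2.
apply: (Ck_mul openT (gC j)); apply: (Ck_linear openT Pm_linear).
apply: (Ck_mul openT _ (gC j)).
exact: (Ck_linear openT (linear_mulr C) (gVC j)).
Qed.

(** In a basis e_i of g, zeta is the combination of the fields
[lifted_killing] of the e_i along gamma, with the coordinates of zeta gamma^-1
as smooth coefficients; the axioms determine the covariant derivative of such a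
combination. *)
Lemma covariant_unique nabQ Dt Dt' zeta t :
  covariant_along G g K k q nabQ gamma Dt -> covariant_along G g K k q nabQ gamma Dt' ->
  HF zeta -> Dt zeta t = Dt' zeta t.
Proof.
move=> [_ DD DZ DF] [_ DD' DZ' DF'] /[dup] zHF /horizontal_alongP[zC zm].
pose e := vbasis g; pose c (i : 'I_(\dim g)) s : R := coord e i (zeta s * (gamma s)^-1).
have eg (i : 'I_(\dim g)) : e`_i \in g.
  by apply: vbasis_mem; apply: mem_nth; rewrite size_tuple.
have cC i : Cinf setT (c i).
  have lc : linear (coord e i : M -> R) by move=> d x y; rewrite linearP.
  by move=> j; exact: (Ck_linear openT lc (Ck_mul openT (zC j) (gVC j))).
have zE : zeta = fun s => \sum_(i <- enum 'I_(\dim g)) c i s *: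
  (lifted_killing e`_i \o gamma) s.
  apply/funext => s; have [Cg CE] := killing_at (gG s) (zm s).
  have zE : gamma s * along_ltriv zeta s = zeta s by rewrite mulVKr.
  rewrite zE in Cg CE; rewrite big_enum /= -[LHS]CE {1}(coord_vbasis Cg).
  exact: (linear_comb (index_enum _) xpredT (c^~ s) (fun i =>
    e`_i) (@killing_linear (gamma s))).
(* a quotient field with value gamma' t at gamma t *)
have [Yg Yt] := killing_at (gG t) (along_velocity_m t); rewrite [RHS]mulVKr // in Yt.
have DE (i : 'I_(\dim g)) : Dt (lifted_killing e`_i \o gamma) t =
  Dt' (lifted_killing e`_i \o gamma) t.
  have YQ := killing_quotient Yg; have ZQ := killing_quotient (eg i).
  by rewrite (DF _ _ t YQ ZQ Yt) (DF' _ _ t YQ ZQ Yt).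
rewrite zE; suff [] : HF (fun s => \sum_(i <- enum 'I_(\dim g)) c i s *:
  (lifted_killing e`_i \o gamma) s)
  /\ Dt (fun s => \sum_(i <- enum 'I_(\dim g)) c i s *:
    (lifted_killing e`_i \o gamma) s) t =
     Dt' (fun s => \sum_(i <- enum 'I_(\dim g)) c i s *:
       (lifted_killing e`_i \o gamma) s) t by [].
elim: (enum _) => [|i r [IHF IHD]].
  rewrite (_ : (fun s => _) = fun s => (cst 0 : R -> R) s *: zeta s); last first.
    by apply/funext => s; rewrite big_nil scale0r.
  have C0 : Cinf setT (cst 0 : R -> R) by move=> j; exact: Ck_cst.
  by split; [exact: horizontal_alongZ|rewrite DZ // DZ' // derive1_cst !scale0r].
rewrite (_ : (fun s => _) = fun s => (fun s =>
  c i s *: (lifted_killing e`_i \o gamma) s) s +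
  (fun s => \sum_(i <- r) c i s *: (lifted_killing e`_i \o gamma) s) s); last first.
  by apply/funext => s; rewrite big_cons.
have kHF := killing_horizontal_along (eg i); have ckHF := horizontal_alongZ (cC i) kHF.
split; first exact: horizontal_alongD.
by rewrite DD // DD' // IHD DZ // DZ' // DE.
Qed.

(** The parallel transport equation in the left trivialisation. *)
Lemma parallelP nabQ zeta : levi_civita_quotient G g K k q nabQ ->
  parallel_along G g K k q nabQ gamma zeta <->
  [/\ Cinf setT zeta, forall t, m (along_ltriv zeta t) &
      forall t, is_derive t (1 : R) (along_ltriv zeta) (- h_christoffel
        (along_velocity t) (along_ltriv zeta t))].
Proof.
move=> LC; have cov := covariant_cov_deriv LC; split.
  move=> [zHF [Dt Dcov D0]]; have [zC zm] := (horizontal_alongP zeta).1 zHF; split=> // t.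
  have := covariant_unique t Dcov cov zHF;
    rewrite D0 => /esym/(congr1 (fun x => (gamma t)^-1 * x)).
  rewrite /cov_deriv mulKr // mulr0 => /eqP; rewrite addr_eq0 => /eqP <-.
  exact: along_ltriv_derive.
move=> [zC zm zd]; split; first exact/horizontal_alongP.
exists cov_deriv => // t.
by rewrite (cov_derivP (zd t)) addNr mulr0.
Qed.

End Along.

(** * Geodesics and parallel transport *)

Lemma Ad_g s t x : s \in g -> x \in g -> Ad s t x \in g.
Proof.
move=> sg xg; rewrite /Ad -expm_inv; apply: (Ad_mem Gsub Glie) => //; exact: (Glie s).1.
Qed.

Lemma Ad_T s t x : s \in a -> x \in g -> T (Ad s t x) = Ad s t (T x).
Proof.
move=> sa xg; apply: (Ad_equivariant (U := g)) T_linear _ _.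
  by move=> y yg; exact: T_ad.
by move=> r; exact: Ad_g (a_sub_g sa) xg.
Qed.

Lemma Ad_Pm s t x : s \in a -> x \in g -> Pm (Ad s t x) = Ad s t (Pm x).
Proof.
move=> sa xg; apply: (Ad_equivariant (U := g)) Pm_linear _ _.
  by move=> y yg; exact: Pm_ad.
by move=> r; exact: Ad_g (a_sub_g sa) xg.
Qed.

Lemma Ad_m s t x : s \in a -> m x -> m (Ad s t x).
Proof. by move=> sa mx; apply/orthocompP;
  rewrite (Ad_Pm _ sa (m_sub_g mx)) ((orthocompP x).1 mx). Qed.

Lemma Ad_h_christoffel s t u v : s \in a -> u \in g -> v \in g ->
  Ad s t (h_christoffel u v) = h_christoffel (Ad s t u) (Ad s t v).
Proof.
move=> sa ug vg; have sg := a_sub_g sa.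
rewrite /h_christoffel /christoffel -!Ad_lie (Ad_Pm _ sa (lie_g ug vg)).
rewrite (Ad_T _ sa ug) (Ad_T _ sa vg) -!Ad_lie.
move: (Pm <|u, v|>) <|T u, v|> <|T v, u|> => x1 x2 x3.
by rewrite AdZ !AdD.
Qed.

Lemma h_christoffel_diag u : h_christoffel u u = <|T u, u|>.
Proof.
rewrite /h_christoffel /christoffel liexx (_ : Pm 0 = 0) ?add0r;
  last exact: (orthocompP 0).1 m0.
by apply/matrixP => i j; rewrite !mxE; field.
Qed.

Lemma h_christoffel_transport V w : <|T V, w|> - h_christoffel V w = transport_gen V w.
Proof.
rewrite /h_christoffel /christoffel /transport_gen /transport_op.
have -> : Pm <|V, w|> = - Pm <|w, V|>.
  have := Pm_linear (-1) <|w, V|> 0; rewrite !scaleN1r !addr0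
    ((orthocompP 0).1 m0) addr0 => <-.
  by rewrite -lieC.
move: (Pm _) <|T V, w|> <|T w, V|> => x1 x2 x3.
by apply/matrixP => i j; rewrite !mxE; field.
Qed.

Lemma transport_gen_linear V : linear (transport_gen V).
Proof.
move=> c u v; rewrite -!h_christoffel_transport h_christoffel_linear lieDr lieZr.
move: (h_christoffel V u) (h_christoffel V v) <|T V, u|> <|T V, v|> => x1 x2 x3 x4.
by apply/matrixP => i j; rewrite !mxE; ring.
Qed.

(** P_a [T x, x] = [T x, P_a x] is proportional to [B w, w] with
w = P_a x, and [B w, w] = - B [w, w] = 0. *)
Lemma Pa_T_lie x : x \in g -> Pa <|T x, x|> = 0.
Proof.
move=> xg; rewrite (Pa_ad (T_mem x) xg) /twist lieDl liexx add0r lieZl lieC.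
rewrite -(B_ad (Pa_mem x) (Pa_mem x)) liexx.
have [[_ Blin] _ _] := hB.
have -> : B 0 = 0 by have := Blin (-1) 0 0 (mem0v _) (mem0v _);
  rewrite scaler0 addr0 scaleN1r addNr.
by rewrite oppr0 scaler0.
Qed.

Section Geodesic.
Context (X V : M) (GX : G X) (mV : m V).
Local Notation S := (T V).

Definition geodesic t := X * expm (t *: (V - S)) * expm (t *: S).

Let Vg : V \in g := m_sub_g mV.
Let Sa : S \in a := T_mem V.
Let Sg : S \in g := a_sub_g Sa.

(** The left velocity of the geodesic: the factor exp (t S) conjugates V,
and S itself is fixed. *)
Definition geod_velocity t := Ad (- S) t V.

Lemma geod_velocity_m t : m (geod_velocity t).
Proof. by apply: Ad_m => //; rewrite memvN. Qed.

Lemma T_geod_velocity t : T (geod_velocity t) = S.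
Proof.
rewrite /geod_velocity Ad_T ?memvN //; have := Ad_self (- S) t.
rewrite /Ad mulrN mulNr => /eqP; rewrite eqr_opp => /eqP.
by [].
Qed.

Lemma geod_velocity_derive t : is_derive t (1 : R) geod_velocity (- <|S, geod_velocity t|>).
Proof.
have := Ad_deriv (- S) (is_derive_cst V t (1 : R)).
rewrite add0r -/(Ad (- S) t _) Ad_lie Ad_self lieNl.
exact.
Qed.

Lemma geodesic_derive t : is_derive t (1 : R) geodesic (geodesic t * geod_velocity t).
Proof.
have d1 : is_derive t (1 : R) (fun s => X * expm (s *: (V - S)))
    (X * (expm (t *: (V - S)) * (V - S))).
  exact: (is_derive1_linear_mx (linear_mull X) (is_derive_expmr (V - S) t)).
have := is_derive1_mulmx d1 (is_derive_expm S t).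
have key (x v w p r r' : M) : r * r' = 1 ->
    x * (p * (v - w)) * r + x * p * (w * r) = x * p * r * (r' * v * r).
  move=> rr; rewrite !mulrA -[x * p * r * r']mulrA rr mulr1.
  by rewrite -mulrDl -mulrDr subrK.
by rewrite (key _ _ _ _ _ _ (expmVr t S)) /geod_velocity /Ad opprK.
Qed.

Lemma geodesic0 : geodesic 0 = X.
Proof. by rewrite /geodesic !expm_scale0 !mulr1. Qed.

Lemma geodesic_G t : G (geodesic t).
Proof.
have [_ Gm _] := Gsub; apply: (Gm); last exact: (Glie S).1 Sg t.
by apply: (Gm) => //; apply: (Glie _).1; exact: memvB Vg Sg.
Qed.

Lemma Cinf_expm (Y : M) : Cinf setT (fun t : R => expm (t *: Y)).
Proof. exact: (Cinf_ode (linear_mull Y) (is_derive_expm Y)). Qed.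

Lemma geodesic_vel t : (geodesic t)^-1 * derive1 geodesic t = geod_velocity t.
Proof.
rewrite derive1E; have [_ ->] := geodesic_derive t.
by rewrite mulKr //; exact: Gu (geodesic_G t).
Qed.

Lemma geodesic_horizontal : horizontal_curve G g k q geodesic.
Proof.
split; last first.
  by move=> t; apply/(HorP _ (geodesic_G t)); rewrite geodesic_vel; exact: geod_velocity_m.
split; last by move=> t; split; [exact: geodesic_G|rewrite geodesic_vel;
  exact/m_sub_g/geod_velocity_m].
move=> j; apply: (Ck_mul openT); last exact: Cinf_expm.
by apply: (Ck_linear openT (linear_mull X)); exact: Cinf_expm.
Qed.

Lemma geodesic_is_geodesic nabQ : levi_civita_quotient G g K k q nabQ ->
  horizontal_geodesic G g K k q nabQ geodesic.
Proof.
move=> LC; have H := geodesic_horizontal; split=> //.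
apply/(parallelP H _ LC).
have e : along_ltriv geodesic (derive1 geodesic) = geod_velocity.
  by apply/funext => t; exact: geodesic_vel.
have e' t : along_velocity geodesic t = geod_velocity t by exact: geodesic_vel.
split; rewrite ?e; first by apply: Cinf_derive1; case: H => -[].
  exact: geod_velocity_m.
by move=> t; rewrite e' h_christoffel_diag T_geod_velocity; exact: geod_velocity_derive.
Qed.

(** With S = T V, the velocity u solves u' = - [T u, u]. By
[Pa_T_lie] the component P_a u is constant, so T u = S, and u is the conjugate
of V by exp (- t S). Then gamma exp (- t S) has constant right-hand generator
V - S. *)
Lemma geodesic_unique nabQ gamma : levi_civita_quotient G g K k q nabQ ->
  horizontal_geodesic G g K k q nabQ gamma -> gamma 0 = X -> derive1 gamma 0 = X * V ->
  gamma = geodesic.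
Proof.
move=> LC [H /(parallelP H _ LC)[_ um ud]] g0 dg0.
pose u := along_velocity gamma; rewrite -/(along_velocity gamma) -/u in um ud.
have u0 : u 0 = V by rewrite /u /along_velocity dg0 g0 mulKr ?Gu.
have gu t : is_derive t (1 : R) gamma (gamma t * u t).
  have := smooth_curveD t H.1; rewrite /u /along_velocity mulVKr //.
  by apply: Gu; have [[_ /(_ t)[]]] := H.
have ud' t : is_derive t (1 : R) u (- <|T (u t), u t|>).
  by rewrite -h_christoffel_diag; exact: ud.
(* the component along a is a constant of the motion *)
have Pac t : Pa (u t) = Pa V.
  rewrite -u0; apply: (is_derive1_cst_eq (f := fun t => Pa (u t))) => s.
  have := is_derive1_linear_mx Pa_lin (ud' s).
  have := Pa_lin (-1) <|T (u s), u s|> 0.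
  rewrite !scaleN1r !addr0 (projg_id av hb_a (mem0v a)) addr0 => ->.
  by rewrite (Pa_T_lie (m_sub_g (um s))) oppr0.
have Tu t : T (u t) = S by rewrite /twist Pac.
have uE t : u t = Ad (- S) t V.
  have c : Ad S t (u t) = V.
    have yd s : is_derive s (1 : R) (fun t => Ad S t (u t)) 0.
      have := Ad_deriv S (ud' s); rewrite Tu addNr.
      by rewrite /Ad mulr0 mul0r.
    by have := is_derive1_cst_eq yd t 0; rewrite Ad0 u0.
  exact: etrans (esym (AdNK S t (u t))) (congr1 (Ad (- S) t) c).
have Yd t : is_derive t (1 : R) (fun s => gamma s * expm (s *: - S))
    (gamma t * expm (t *: - S) * (V - S)).
  have := is_derive1_mulmx (gu t) (is_derive_expmr (- S) t).
    have key (p v w r r' : M) : r * r' = 1 ->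
      p * (r' * v * r) * r' + p * (r' * - w) = p * r' * (v - w).
    by move=> rr; rewrite -!mulrA rr mulr1 -mulrDr -mulrDr.
  by rewrite uE /Ad opprK (key _ _ _ _ _ (expmVr t S)).
have := mulr_ode Yd; rewrite /= expm_scale0 mulr1 g0 => YE.
apply/funext => t; rewrite /geodesic -YE -mulrA expmVl mulr1.
by [].
Qed.

(** Conjugation by exp (t S) commutes with the Christoffel term and
sends the velocity back to V; what remains is [S, w] - Gamma (V, w) = P_V w. *)
Lemma parallel_Ad t v : v \in g ->
  Ad S t (- h_christoffel (geod_velocity t) v + <|S, v|>) = transport_gen V (Ad S t v).
Proof.
move=> vg; have e : Ad S t (geod_velocity t) = V by exact: AdK.
have e2 : h_christoffel V (Ad S t v) = Ad S t (h_christoffel (geod_velocity t) v).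
  by rewrite (Ad_h_christoffel t Sa (m_sub_g (geod_velocity_m t)) vg) e.
by rewrite -(h_christoffel_transport V (Ad S t v)) e2 addrC AdB Ad_lie Ad_self.
Qed.

Lemma parallel_unique nabQ zeta t : levi_civita_quotient G g K k q nabQ ->
  parallel_along G g K k q nabQ geodesic zeta ->
  zeta t = X * expm (t *: (V - S)) * expv (fun x => t *: transport_gen V x) (X^-1 * zeta 0)
           * expm (t *: S).
Proof.
move=> LC /(parallelP geodesic_horizontal _ LC)[_ vm vd].
pose w t := Ad S t (along_ltriv geodesic zeta t).
have wd s : is_derive s (1 : R) w (transport_gen V (w s)).
  have e : along_velocity geodesic s = geod_velocity s by exact: geodesic_vel.
  rewrite /w -(parallel_Ad s (m_sub_g (vm s))) -e.
  exact: (Ad_deriv S (vd s)).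
have := expv_unique (transport_gen_linear V) wd t.
rewrite {2}/w Ad0 /along_ltriv geodesic0 => <-.
have key (p r r' z : M) : r' * r = 1 -> p * (r * z * r') * r = p * r * z.
  by move=> rr; rewrite -!mulrA rr mulr1.
rewrite /w /Ad (key _ _ _ _ (expmVl t S)) /along_ltriv.
exact: esym (mulVKr (Gu (geodesic_G t)) (zeta t)).
Qed.

Definition parallel_field eta t :=
  X * expm (t *: (V - S)) * expv (fun x =>
    t *: transport_gen V x) (X^-1 * eta) * expm (t *: S).

Lemma parallel_field0 eta : parallel_field eta 0 = eta.
Proof. by rewrite /parallel_field !expm_scale0 !mulr1 expv0 mulVKr ?Gu. Qed.

Lemma iter_transport_gen_m x t j : m x -> m (iter j (fun x => t *: transport_gen V x) x).
Proof. by move=> mx; elim: j => // j IH; rewrite iterS; apply/mZ/transport_gen_m. Qed.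

Lemma parallel_field_parallel nabQ eta : levi_civita_quotient G g K k q nabQ ->
  m (X^-1 * eta) -> parallel_along G g K k q nabQ geodesic (parallel_field eta).
Proof.
move=> LC meta; apply/(parallelP geodesic_horizontal _ LC).
pose w t := expv (fun x => t *: transport_gen V x) (X^-1 * eta).
have wd t : is_derive t (1 : R) w (transport_gen V (w t)).
  exact: (is_derive_expvL (transport_gen_linear V)).
have wm t : m (w t).
  by apply/orthocompP; apply: (expv_fix (transport_gen_linear V)) Pm_linear _ => j;
    apply/orthocompP/iter_transport_gen_m.
have tE t : along_ltriv geodesic (parallel_field eta) t = Ad (- S) t (w t).
  rewrite /along_ltriv; apply: (mulrI (Gu (geodesic_G t))); rewrite mulVKr ?Gu //;
    last exact: geodesic_G.
  have key (p r r' z : M) : r * r' = 1 -> p * z * r = p * r * (r' * z * r).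
    by move=> rr; rewrite !mulrA -[p * r * r']mulrA rr mulr1.
  by rewrite /parallel_field -/(w t) /geodesic /Ad opprK; exact: key (expmVr t S).
split.
- move=> j; apply: (Ck_mul openT); last exact: Cinf_expm.
  apply: (Ck_mul openT); last exact: (Cinf_ode (transport_gen_linear V) wd).
  by apply: (Ck_linear openT (linear_mull X)); exact: Cinf_expm.
- by move=> t; rewrite tE; apply: Ad_m => //; rewrite memvN.
move=> t; have e : along_velocity geodesic t = geod_velocity t by exact: geodesic_vel.
have := Ad_deriv (- S) (wd t).
rewrite (_ : (fun s => _) = along_ltriv geodesic (parallel_field eta)); last first.
  by apply/funext => s; rewrite tE.
rewrite tE e.
have wg : Ad (- S) t (w t) \in g.
  by apply: Ad_g; [rewrite memvN|exact: m_sub_g].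
have := parallel_Ad t wg; rewrite AdK => /(congr1 (Ad (- S) t)); rewrite AdNK => PE.
rewrite -/(Ad (- S) t _) AdD -PE Ad_lie Ad_self lieNl addrK.
exact.
Qed.

End Geodesic.

(** * The horizontal connection and the transport operator *)

(** From here on the operators are identified with those of the theorem,
which are built from [orthproj] and agree with the linear ones on g only. *)
Lemma twistE V : V \in g ->
  orthproj b [set` a] V + beta0^-1 *: B (orthproj b [set` a] V) = T V.
Proof. by move=> Vg; rewrite PaE. Qed.

Lemma transport_genE V C : m V -> m C ->
  2^-1 *: (orthproj b m <|C, V|>
    + <|orthproj b [set` a] V + beta0^-1 *: B (orthproj b [set` a] V), C|>
    - <|orthproj b [set` a] C + beta0^-1 *: B (orthproj b [set` a] C), V|>) =
      transport_gen V C.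
Proof.
by move=> mV mC; rewrite (twistE (m_sub_g mV)) (twistE (m_sub_g mC)) (PmE (lie_g
  (m_sub_g mC) (m_sub_g mV))).
Qed.

Lemma christoffelE X xi eta : G X -> X^-1 * xi \in g -> X^-1 * eta \in g ->
  - (2^-1 *: (xi * X^-1 * eta + eta * X^-1 * xi
       + X * orthproj b [set` k] <|X^-1 * xi, X^-1 * eta|>))
  + 2^-1 *: (X * (<|orthproj b [set` a] (X^-1 * xi)
                    + beta0^-1 *: B (orthproj b [set` a] (X^-1 * xi)), X^-1 * eta|>
                 + <|orthproj b [set` a] (X^-1 * eta)
                    + beta0^-1 *: B (orthproj b [set` a] (X^-1 * eta)), X^-1 * xi|>)) =
  X * (h_christoffel (X^-1 * xi) (X^-1 * eta) - X^-1 * xi * (X^-1 * eta)).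
Proof.
move=> GX; have Xu := Gu GX.
have -> : xi * X^-1 * eta = X * (X^-1 * xi * (X^-1 * eta)) by rewrite !mulrA mulrV // mul1r.
have -> : eta * X^-1 * xi = X * (X^-1 * eta * (X^-1 * xi)) by rewrite !mulrA mulrV // mul1r.
move: (X^-1 * xi) (X^-1 * eta) => u v ug vg.
rewrite (twistE ug) (twistE vg) (PkE (lie_g ug vg)) /h_christoffel /christoffel /projm.
rewrite (projv_id (lie_g ug vg)) -!mulrDr scalerAr -mulrN scalerAr -mulrDr; congr (_ * _).
move: (Pk <|u, v|>) <|T u, v|> <|T v, u|> => x1 x2 x3; rewrite /lie_bracket.
move: (u * v) (v * u) => x4 x5.
by apply/matrixP => i j; rewrite !mxE; field.
Qed.

Lemma connection_formula nabG Y Z X : levi_civita_G G g q nabG ->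
  horizontal_field G g k q Y -> horizontal_field G g k q Z -> G X ->
  horizontal_connection g k q nabG Y Z X = dirD Z X (Y X) +
    X * (h_christoffel (X^-1 * Y X) (X^-1 * Z X) - X^-1 * Y X * (X^-1 * Z X)).
Proof.
move=> LC YH ZH GX; rewrite (connectionG LC YH ZH GX) /dltriv /ltriv.
rewrite -addrA mulrDr mulVKr ?Gu //; congr (_ + X * _).
by rewrite addrC.
Qed.

Lemma expv_transport_genE V t x : m V -> m x ->
  expv (fun C => t *: (2^-1 *: (orthproj b m <|C, V|>
    + <|orthproj b [set` a] V + beta0^-1 *: B (orthproj b [set` a] V), C|>
    - <|orthproj b [set` a] C + beta0^-1 *: B (orthproj b [set` a] C), V|>))) x =
  expv (fun y => t *: transport_gen V y) x.
Proof.
move=> mV mx; refine (@eq_expv_in _ _ m _ _ _ mx _ _) => y my.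
  exact: (mZ t (transport_gen_m mV my)).
exact: (congr1 (fun z => t *: z) (transport_genE mV my)).
Qed.

End HorizontalGeometry.

Theorem theorem4 (R : realType) (n : nat)
  (G A K : set 'M[R]_n.+1) (g a k : {vspace 'M[R]_n.+1})
  (b : 'M[R]_n.+1 -> 'M[R]_n.+1 -> R)
  (B : 'M[R]_n.+1 -> 'M[R]_n.+1) (beta0 : R)
  (hG : connected_lie_subgroup G g)
  (hA : connected_lie_subgroup A a)
  (hAG : A `<=` G)
  (hb : bi_invariant G g b)
  (hb_g : nondegenerate_on g b)
  (hb_a : nondegenerate_on a b)
  (hB : intertwining A a b B)
  (hB_inv : set_bij [set` a] [set` a] B)
  (hbeta0 : beta0 != 0)
  (hK : closed_lie_subgroup G g K k)
  (hKA : forall X Y, K X -> A Y -> X * Y = Y * X)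
  (hb_k : nondegenerate_on k b)
  (hka : forall X Y, X \in k -> Y \in a -> lie_bracket X Y = 0)
  (hka_orth : forall X Y, X \in k -> Y \in a -> b X Y = 0)
  (nabG nabQ : ('M[R]_n.+1 -> 'M[R]_n.+1) -> ('M[R]_n.+1 -> 'M[R]_n.+1) ->
               'M[R]_n.+1 -> 'M[R]_n.+1)
  (hnabG : levi_civita_G G g (form_beta b a beta0 B) nabG)
  (hnabQ : levi_civita_quotient G g K k (form_beta b a beta0 B) nabQ) :
  let q := form_beta b a beta0 B in
  let m := orthocomp b g k in
  let Pa := orthproj b [set` a] in
  let Pk := orthproj b [set` k] in
  let Pm := orthproj b m in
  let T := fun V => Pa V + beta0^-1 *: B (Pa V) in
  let Gamma := fun X xi eta =>
    - (2^-1 *: (xi * X^-1 * eta + eta * X^-1 * xi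
                + X * Pk (lie_bracket (X^-1 * xi) (X^-1 * eta))))
    + 2^-1 *: (X * (lie_bracket (T (X^-1 * xi)) (X^-1 * eta)
                    + lie_bracket (T (X^-1 * eta)) (X^-1 * xi))) in
  let geod := fun X xi (t : R) =>
    X * expm (t *: (- T (X^-1 * xi) + X^-1 * xi)) * expm (t *: T (X^-1 * xi)) in
  let P := fun V C =>
    2^-1 *: (Pm (lie_bracket C V) + lie_bracket (T V) C
             - lie_bracket (T C) V) in
  [/\ forall X, G X -> Hor g k q X = [set X * V | V in m],
      forall Y Z, horizontal_field G g k q Y -> horizontal_field G g k q Z ->
        forall X, G X ->
          horizontal_connection g k q nabG Y Z X =
          dirD Z X (Y X) + Gamma X (Y X) (Z X),
      forall X xi, G X -> Hor g k q X xi ->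
        forall gamma : R -> 'M[R]_n.+1,
          [/\ horizontal_geodesic G g K k q nabQ gamma,
              gamma 0 = X & derive1 gamma 0 = xi]
          <-> gamma = geod X xi,
      forall X xi eta, G X -> Hor g k q X xi -> Hor g k q X eta ->
        let V := X^-1 * xi in
        forall (t : R) (eta' : 'M[R]_n.+1),
          parallel_transport G g K k q nabQ (geod X xi) t eta eta' <->
          eta' = X * expm (t *: (V - T V))
                 * expv (fun C => t *: P V C) (X^-1 * eta)
                 * expm (t *: T V) &
      forall V, m V ->
        (forall C, m C -> m (P V C)) /\
        (forall C D, m C -> m D -> q (P V C) D = - q C (P V D))].
Proof.
move=> q m Pa Pk Pm T Gamma geod P.
have horP X xi (GX : G X) : Hor g k q X xi <-> m (X^-1 * xi) :=
  HorP hG hA hAG hb hb_a hB hbeta0 hK hka_orth xi GX.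
have TE V : m V -> T V = twist g a b B beta0 V.
  by move=> mV; exact: (twistE a b B beta0 (m_sub_g mV)).
have geodE X xi : m (X^-1 * xi) -> geod X xi = geodesic g a b B beta0 X (X^-1 * xi).
  by move=> mV; apply/funext => t; rewrite /geod (TE _ mV) [- _ + _]addrC.
split.
- by move=> X GX; exact: (HorE hG hA hAG hb hb_a hB hbeta0 hK hka_orth GX).
- move=> Y Z YH ZH X GX.
  rewrite (connection_formula hG hA hAG hb hb_g hb_a hB hB_inv hbeta0 hK hb_k hka
             hka_orth hnabG YH ZH GX).
  have mY := (horP _ _ GX).1 (YH.2 X GX); have mZ := (horP _ _ GX).1 (ZH.2 X GX).
  by rewrite -(christoffelE a k b B beta0 hG GX (m_sub_g mY) (m_sub_g mZ)).
- move=> X xi GX Hxi gamma; have mV := (horP _ _ GX).1 Hxi.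
  have XV : X * (X^-1 * xi) = xi by rewrite mulVKr //; apply: (G_unit _ GX); case: hG.
  rewrite (geodE _ _ mV); split=> [[gg g0 dg0]|->].
    apply: (geodesic_unique hG hA hAG hb hb_g hb_a hB hB_inv hbeta0 hK hb_k hka
              hka_orth GX hnabQ gg g0).
    by rewrite XV.
  split.
  + exact: (geodesic_is_geodesic hG hA hAG hb hb_g hb_a hB hB_inv hbeta0 hK hb_k hka
              hka_orth GX mV hnabQ).
  + exact: geodesic0.
  rewrite derive1E.
  have [_ ->] := geodesic_derive g a b B beta0 X (X^-1 * xi) 0.
  by rewrite geodesic0 /geod_velocity Ad0.
- move=> X xi eta GX Hxi Heta V t eta'.
  have mV := (horP _ _ GX).1 Hxi; have meta := (horP _ _ GX).1 Heta.
  rewrite (geodE _ _ mV) (TE _ mV).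
  rewrite (expv_transport_genE beta0 hG hA hAG hb hb_g hb_a hB hK hb_k hka hka_orth t mV meta)
    .
  split=> [[zeta [par z0 <-]]|->].
    rewrite -z0.
    exact: (parallel_unique hG hA hAG hb hb_g hb_a hB hB_inv hbeta0 hK hb_k hka
              hka_orth GX mV t hnabQ par).
  exists (parallel_field g a k b B beta0 X V eta); split.
  + exact: (parallel_field_parallel hG hA hAG hb hb_g hb_a hB hB_inv hbeta0 hK hb_k hka
              hka_orth GX mV hnabQ meta).
  + exact: (parallel_field0 a k b B beta0 hG V GX).
  by [].
- move=> V mV; split=> [C mC|C D mC mD].
    rewrite /P (transport_genE B beta0 hG hA hAG hb hb_g hK hb_k hka_orth mV mC).
    exact: (transport_gen_m beta0 hG hA hAG hb hb_a hB hK hb_k hka hka_orth mV mC).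
  rewrite /P (transport_genE B beta0 hG hA hAG hb hb_g hK hb_k hka_orth mV mC).
  rewrite (transport_genE B beta0 hG hA hAG hb hb_g hK hb_k hka_orth mV mD).
  exact: (transport_gen_antisym hG hA hAG hb hb_a hB hbeta0 hK hb_k hka hka_orth mV mC mD).
Qed.
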